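(* Let $A \subseteq \mathbb{N}$. If $A$ is superduperlow, i.e. $A' \le_{btt} K$, then $A$ is decidable (computable).
   Context: $M_0, M_1, \ldots$ is a standard list of Turing machines and $M_0^{()}, M_1^{()}, \ldots$ is a standard list of oracle Turing machines. $K = \{ e : M_e(e) \text{ halts} \}$ is the halting set. For a set $A \subseteq \mathbb{N}$, $A' = \{ e : M_e^A(e) \text{ halts} \}$ is the Turing jump of $A$. The relation $\le_{btt}$ is bounded truth-table reducibility: $X \le_{btt} Y$ means there is a constant $k$ and a computable procedure that, on input $x$, produces (without consulting any oracle) numbers $y_1, \ldots, y_k$ and a Boolean function $\beta : \{0,1\}^k \to \{0,1\}$ such that $X(x) = \beta(Y(y_1), \ldots, Y(y_k))$, where sets are identified with their characteristic functions. A set $A$ is superduperlow if $A' \le_{btt} K$. *)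

(* Defs.v *)
From Stdlib Require Cantor.
From mathcomp Require Import all_boot.
From mathcomp Require Import boolp classical_sets.

Set Implicit Arguments.
Unset Strict Implicit.
Unset Printing Implicit Defensive.

(* MathComp, with the classical sets [set nat] of MathComp-Analysis for subsets
   of N; for [A : set nat], the boolean [x \in A] is the characteristic function
   of [A] at [x]. *)

(** * Turing machines

   A tape is one-way infinite, its cells being numbered 0, 1, 2, ...; moving
   left from cell 0 leaves the head there. Symbols and states are natural
   numbers, the blank being 0 and the initial state 0; a machine is a finite
   table, so that it only ever uses finitely many of them. When several rules
   of the table apply the first one is used, so that every table is a
   deterministic machine, which halts exactly when no rule applies. *)

Inductive dir := Left | Stay | Right.

Definition move (d : dir) (p : nat) : nat :=
  match d with Left => p.-1 | Stay => p | Right => p.+1 end.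

Definition write (t : nat -> nat) (p s : nat) : nat -> nat :=
  fun i => if i == p then s else t i.

Record rule := Rule {
  r_state : nat; r_read : nat; r_next : nat; r_write : nat; r_move : dir }.

Record config := Config { c_state : nat; c_head : nat; c_tape : nat -> nat }.

Definition applies (c : config) (r : rule) : bool :=
  (r_state r == c_state c) && (r_read r == c_tape c (c_head c)).

Definition step (M : seq rule) (c : config) : option config :=
  if [seq r <- M | applies c r] is r :: _ then
    Some (Config (r_next r) (move (r_move r) (c_head c))
                 (write (c_tape c) (c_head c) (r_write r)))
  else None.

(* Oracle machines have a second, read-only tape, with its own head, on which
   the characteristic function of the oracle is written. *)

Record orule := ORule {
  or_state : nat; or_read : nat; or_oread : bool;
  or_next : nat; or_write : nat; or_move : dir; or_omove : dir }.

Record oconfig := OConfig {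
  oc_state : nat; oc_head : nat; oc_tape : nat -> nat; oc_ohead : nat }.

Definition oapplies (A : set nat) (c : oconfig) (r : orule) : bool :=
  [&& or_state r == oc_state c, or_read r == oc_tape c (oc_head c)
    & or_oread r == (oc_ohead c \in A)].

Definition ostep (A : set nat) (M : seq orule) (c : oconfig) : option oconfig :=
  if [seq r <- M | oapplies A c r] is r :: _ then
    Some (OConfig (or_next r) (move (or_move r) (oc_head c))
                  (write (oc_tape c) (oc_head c) (or_write r))
                  (move (or_omove r) (oc_ohead c)))
  else None.

(** * Runs *)

Fixpoint run (C : Type) (next : C -> option C) (n : nat) (c : C) : C :=
  if n is n'.+1 then
    if next c is Some c' then run next n' c' else c
  else c.

Definition halts_at (C : Type) (next : C -> option C) (c c' : C) : Prop :=
  (exists n, run next n c = c') /\ next c' = None.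

Definition halts (C : Type) (next : C -> option C) (c : C) : Prop :=
  exists c', halts_at next c c'.

(* Numbers are represented in unary, from cell 0. *)

Definition input_tape (x : nat) : nat -> nat := fun i => nat_of_bool (i < x).

Definition tape_output (t : nat -> nat) (y : nat) : Prop :=
  (forall i, i < y -> t i = 1) /\ t y = 0.

Definition init (x : nat) : config := Config 0 0 (input_tape x).

Definition oinit (x : nat) : oconfig := OConfig 0 0 (input_tape x) 0.

(** * The standard lists of machines

   Finite tables are numbered by means of Cantor's pairing function. *)

Definition pair_code (x y : nat) : nat := Cantor.to_nat (x, y).

Fixpoint seq_code (s : seq nat) : nat :=
  if s is x :: s' then (pair_code x (seq_code s')).+1 else 0.

(* The first argument is fuel; [n] is enough for decoding [n]. *)
Fixpoint seq_decode_rec (fuel n : nat) : seq nat :=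
  match fuel, n with
  | f.+1, m.+1 => let (x, m') := Cantor.of_nat m in x :: seq_decode_rec f m'
  | _, _ => [::]
  end.

Definition seq_decode (n : nat) : seq nat := seq_decode_rec n n.

Definition dir_decode (n : nat) : dir :=
  match n with 0 => Left | 1 => Right | _ => Stay end.

Definition rule_decode (n : nat) : rule :=
  let (q, n1) := Cantor.of_nat n in
  let (s, n2) := Cantor.of_nat n1 in
  let (q', n3) := Cantor.of_nat n2 in
  let (s', d) := Cantor.of_nat n3 in
  Rule q s q' s' (dir_decode d).

Definition orule_decode (n : nat) : orule :=
  let (q, n1) := Cantor.of_nat n in
  let (s, n2) := Cantor.of_nat n1 in
  let (b, n3) := Cantor.of_nat n2 in
  let (q', n4) := Cantor.of_nat n3 in
  let (s', n5) := Cantor.of_nat n4 in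
  let (d, od) := Cantor.of_nat n5 in
  ORule q s (b != 0) q' s' (dir_decode d) (dir_decode od).

Definition TM (e : nat) : seq rule := map rule_decode (seq_decode e).

Definition OTM (e : nat) : seq orule := map orule_decode (seq_decode e).

Lemma seq_codeK : cancel seq_code seq_decode.
Proof.
move=> s; rewrite /seq_decode; move: (leqnn (seq_code s)).
elim: s {2 3}(seq_code s) => [|x s IHs] [|n] //=.
rewrite ltnS => le_n; rewrite /pair_code Cantor.cancel_of_to IHs //.
apply: leq_trans le_n; rewrite /pair_code.
have /leP := Cantor.to_nat_non_decreasing x (seq_code s).
exact/leq_trans/leq_addr.
Qed.

Lemma dir_decode_surj d : exists n, dir_decode n = d.
Proof. by case: d; [exists 0 | exists 2 | exists 1]. Qed.

Lemma map_decode_surj (T : Type) (f : nat -> T) :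
  (forall r, exists n, f n = r) ->
  forall M, exists e, map f (seq_decode e) = M.
Proof.
move=> f_surj M; suff [s <-] : exists s, map f s = M.
  by exists (seq_code s); rewrite seq_codeK.
elim: M => [|r M [s <-]]; first by exists [::].
by have [n <-] := f_surj r; exists (n :: s).
Qed.

Lemma TM_surj (M : seq rule) : exists e, TM e = M.
Proof.
apply: map_decode_surj => -[q s q' s' d]; have [n <-] := dir_decode_surj d.
exists (pair_code q (pair_code s (pair_code q' (pair_code s' n)))).
by rewrite /rule_decode /pair_code !Cantor.cancel_of_to.
Qed.

Lemma OTM_surj (M : seq orule) : exists e, OTM e = M.
Proof.
apply: map_decode_surj => -[q s b q' s' d od].
have [n <-] := dir_decode_surj d; have [m <-] := dir_decode_surj od.
exists (pair_code q (pair_code s (pair_code b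
         (pair_code q' (pair_code s' (pair_code n m)))))).
by rewrite /orule_decode /pair_code !Cantor.cancel_of_to; case: b.
Qed.

(** * Computability, the halting set, the jump *)

Definition computable (f : nat -> nat) : Prop :=
  exists e, forall x, exists c,
    halts_at (step (TM e)) (init x) c /\ tape_output (c_tape c) (f x).

Definition computable_set (A : set nat) : Prop :=
  computable (fun x => nat_of_bool (x \in A)).

Definition K : set nat := [set e | halts (step (TM e)) (init e)]%classic.

Definition jump (A : set nat) : set nat :=
  [set e | halts (ostep A (OTM e)) (oinit e)]%classic.

(** * Bounded truth-table reducibility

   The output of the reduction procedure, numbers y_1, ..., y_k and a Boolean
   function of k variables, is coded by a single number; the Boolean function is
   given by its truth table, i.e., the list of its values over the enumeration
   of [k.-tuple bool]. *)

Definition btt_code (k : nat) (ys : k.-tuple nat)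
    (beta : {ffun k.-tuple bool -> bool}) : nat :=
  pair_code (seq_code ys) (seq_code (map nat_of_bool (codom beta))).

Definition btt_reducible (X Y : set nat) : Prop :=
  exists (k : nat) (ys : nat -> k.-tuple nat)
         (beta : nat -> {ffun k.-tuple bool -> bool}),
    computable (fun x => btt_code (ys x) (beta x)) /\
    forall x, (x \in X) = beta x [tuple of map (fun y => y \in Y) (ys x)].

Definition superduperlow (A : set nat) : Prop := btt_reducible (jump A) K.

(* Main.v *)
Require Import Defs.
From mathcomp Require Import all_boot.
From mathcomp Require Import boolp classical_sets.
From mathcomp Require Import zify.

Set Implicit Arguments.
Unset Strict Implicit.
Unset Printing Implicit Defensive.

(** Suppose that the jump of A is reducible to K by truth tables with k queries.
    Only very weak instances of the jump are needed: for n and u < 2^n there is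
    an oracle machine, computable from n and u, that halts exactly when the
    parity of the bits of A below n selected by the binary digits of u is odd
    ([jump_parity]). The reduction turns each such parity into k questions
    about K. Enumerating K up to a stage t gives a guess at the parity, and the
    guess can be wrong only if one of the k questions is answered positively
    after stage t.

    Let c(n) be the number of positive answers, over all u < 2^n, so that
    c(n) / 2^n lies between 0 and k. Up to an error of 1/8, the upper limit of
    this quotient is finite information: there are j and n0 such that
    j 2^n <= 8 c(n) for infinitely many n, but 8 c(n) < (j+1) 2^n for all
    n >= n0. To decide whether x is in A, search for n >= n0 with n > x and for
    a stage t at which already j 2^n <= 8 c_t(n), where c_t(n) counts the
    positive answers found by stage t. Fewer than 2^n / 8 positive answers are
    still to come, so fewer than 2^n / 8 of the guessed parities are wrong.
    The 2^n parities form the Hadamard encoding of A below n, and a code word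
    corrupted in less than an eighth of its positions can be decoded locally:
    adding x to the selected set changes the parity exactly when x is in A, so a
    majority vote over u on whether the guess changes is correct
    ([majority_decoding]).

    The proof is not uniform: j, n0 and k are built into the decision procedure
    as constants.

    The remainder makes the search an actual Turing machine. Programs with
    loops over registers are compiled to a machine whose symbols are bit
    vectors, one bit for each register ([computable_of_exec]); the functions
    [rec] computed by such programs are closed under the usual schemes
    ([rec_subst], [rec_iteri], [rec_min]), hence include the step function of a
    coded Turing machine ([code_stepP]). This gives the enumeration of K, and
    also converts the reduction, a function computed by some machine, into a
    function computed by a program ([rec_of_computable]). *)

(** * Binary numerals *)

(** The binary digits serve twice: tape symbols of the constructed machines are
    bit vectors, and numbers below 2^n stand for subsets of {0, ..., n-1}. *)
Definition bit (u i : nat) : bool := odd (u %/ 2 ^ i).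

Definition num (b : nat -> bool) (n : nat) : nat := \sum_(i < n) b i * 2 ^ i.

Lemma bit0 u : bit u 0 = odd u.
Proof. by rewrite /bit divn1. Qed.

Lemma bitS u i : bit u i.+1 = bit u./2 i.
Proof. by rewrite /bit expnS divnMA divn2. Qed.

Lemma numS b n : num b n.+1 = b 0 + (num (fun i => b i.+1) n).*2.
Proof.
rewrite /num big_ord_recl muln1 -muln2 big_distrl /=; congr addn.
by apply: eq_bigr => i _; rewrite expnSr mulnA.
Qed.

Lemma eq_num b b' n : (forall i, i < n -> b i = b' i) -> num b n = num b' n.
Proof. by move=> eqb; apply: eq_bigr => i _; rewrite eqb. Qed.

Lemma num_lt b n : num b n < 2 ^ n.
Proof.
elim: n b => [|n IHn] b; first by rewrite /num big_ord0.
by rewrite numS expnS mul2n; have := IHn (fun i => b i.+1); case: (b 0); lia.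
Qed.

Lemma bit_num b n i : i < n -> bit (num b n) i = b i.
Proof.
elim: n i b => [|n IHn] [|i] b lt_in //; rewrite numS.
  by rewrite bit0 oddD odd_double addbF oddb.
by rewrite bitS half_bit_double IHn.
Qed.

Lemma num_bit u n : u < 2 ^ n -> num (bit u) n = u.
Proof.
elim: n u => [|n IHn] u; first by rewrite /num big_ord0 ltnS leqn0 => /eqP.
rewrite expnS mul2n => lt_u; rewrite numS bit0 -[RHS]odd_double_half.
congr (_ + _.*2); rewrite -(IHn u./2); last by lia.
by apply: eq_num => i _; rewrite bitS.
Qed.

(** * Programs over registers *)

Inductive com :=
  Skip | Inc of nat | Dec of nat | Seq of com & com | While of nat & com.

Inductive exec : com -> (nat -> nat) -> (nat -> nat) -> Prop :=
| ExecSkip s : exec Skip s s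
| ExecInc i s : exec (Inc i) s (write s i (s i).+1)
| ExecDec i s : exec (Dec i) s (write s i (s i).-1)
| ExecSeq c c' s s' s'' :
    exec c s s' -> exec c' s' s'' -> exec (Seq c c') s s''
| ExecWhile0 i c s : s i = 0 -> exec (While i c) s s
| ExecWhileS i c s s' s'' : s i <> 0 ->
    exec c s s' -> exec (While i c) s' s'' -> exec (While i c) s s''.

Fixpoint com_bound (c : com) : nat :=
  match c with
  | Skip => 0
  | Inc i | Dec i => i.+1
  | Seq c c' => maxn (com_bound c) (com_bound c')
  | While i c => maxn i.+1 (com_bound c)
  end.

Inductive instr := IInc of nat | IDec of nat | IBranch of nat & nat & nat.

Definition ireg (a : instr) : nat :=
  match a with IInc j | IDec j | IBranch j _ _ => j end.

Definition istep (P : seq instr) (c : nat * (nat -> nat)) :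
    option (nat * (nat -> nat)) :=
  let: (pc, s) := c in
  match onth P pc with
  | Some (IInc j) => Some (pc.+1, write s j (s j).+1)
  | Some (IDec j) => Some (pc.+1, write s j (s j).-1)
  | Some (IBranch j l l') => Some (if s j == 0 then l else l', s)
  | None => None
  end.

(** The code of [c] placed at address [p]. A loop is tested both before and
    after its body; the two copies of the test have the same targets. *)
Fixpoint compile (c : com) (p : nat) : seq instr :=
  match c with
  | Skip => [::]
  | Inc i => [:: IInc i]
  | Dec i => [:: IDec i]
  | Seq c c' => let P := compile c p in P ++ compile c' (p + size P)
  | While i c =>
      let P := compile c p.+1 in
      let test := IBranch i (p + size P).+2 p.+1 in
      test :: rcons P test
  end.

Definition reach (C : Type) (next : C -> option C) (c c' : C) : Prop :=
  exists n, run next n c = c'.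

Lemma run_halted (C : Type) (next : C -> option C) n c :
  next c = None -> run next n c = c.
Proof. by case: n => //= n ->. Qed.

Lemma runD (C : Type) (next : C -> option C) m n c :
  run next (m + n) c = run next n (run next m c).
Proof.
elim: m c => [|m IHm] c //; rewrite addSn /=.
by case E: (next c) => [c'|] //; rewrite run_halted.
Qed.

Lemma reach_refl (C : Type) (next : C -> option C) c : reach next c c.
Proof. by exists 0. Qed.

Lemma reach_trans (C : Type) (next : C -> option C) c c' c'' :
  reach next c c' -> reach next c' c'' -> reach next c c''.
Proof. by move=> [m <-] [n <-]; exists (m + n); rewrite runD. Qed.

Lemma reach_step (C : Type) (next : C -> option C) c c' c'' :
  next c = Some c' -> reach next c' c'' -> reach next c c''.
Proof. by move=> E [n <-]; exists n.+1; rewrite /= E. Qed.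

Lemma reach1 (C : Type) (next : C -> option C) c c' :
  next c = Some c' -> reach next c c'.
Proof. by move=> E; exists 1; rewrite /= E. Qed.

Lemma onth_mid (T : Type) (s1 s2 : seq T) x :
  onth (s1 ++ x :: s2) (size s1) = Some x.
Proof. by elim: s1. Qed.

(** By induction on the execution: the run on the compiled code, wherever it is
    placed, follows the structured program. *)
Lemma compile_reach c s s' : exec c s s' -> forall pre post,
  reach (istep (pre ++ compile c (size pre) ++ post))
    (size pre, s) (size pre + size (compile c (size pre)), s').
Proof.
elim=> {c s s'}
  [s|i s|i s|c c' s s' s'' _ IHc _ IHc'|i c s s0|i c s s' s'' s0 _ IHc _ IHw]
  pre post /=.
- by rewrite addn0; apply: reach_refl.
- by apply: reach1; rewrite /= onth_mid addn1.
- by apply: reach1; rewrite /= onth_mid addn1.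
- set P := compile c _.
  apply: reach_trans (_ : reach _ (size pre + size P, s') _).
    by rewrite -catA; apply: IHc.
  have := IHc' (pre ++ P) post; rewrite !size_cat !catA addnA; exact.
- apply: reach1; rewrite /= onth_mid s0 /= size_rcons; congr (Some (_, _)); lia.
- set P := compile c _; set test := IBranch _ _ _.
  set l := (size pre + size P).+2.
  have EP : pre ++ test :: rcons P test ++ post =
            rcons pre test ++ P ++ test :: post.
    by rewrite -cats1 -[rcons pre _]cats1 -!catA.
  have Eat : onth (pre ++ test :: rcons P test ++ post) (size pre + size P).+1
             = Some test.
    rewrite EP catA -[in X in onth _ X]addSn -(size_rcons pre test) -size_cat.
    exact: onth_mid.
  have El : size pre + (size (rcons P test)).+1 = l by rewrite size_rcons; lia.
  have Eb : reach (istep (pre ++ test :: rcons P test ++ post))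
              ((size pre).+1, s) ((size pre + size P).+1, s').
    by rewrite EP; have := IHc (rcons pre test) (test :: post);
       rewrite size_rcons addSn.
  have E0 : istep (pre ++ test :: rcons P test ++ post) (size pre, s)
            = Some ((size pre).+1, s).
    by rewrite /= onth_mid /=; case: eqP.
  apply: reach_step E0 _; apply: reach_trans Eb _.
  have := IHw pre post; rewrite /= -/P -/test El => Ew.
  case: Ew => -[|n].
    move=> [Ep <-]; exfalso; move: Ep; rewrite /l; lia.
  (* the second test decides as the first one would *)
  move=> <-; exists n.+1; move: Eat (onth_mid pre (rcons P test ++ post) test).
  move: (pre ++ _) => Q Eat E0'.
  by rewrite [LHS]/= [RHS]/= -[in LHS]/(onth _ _.+1) Eat E0'.
Qed.

(** * Programs as Turing machines *)

Definition put (b : nat -> bool) (j : nat) (v : bool) : nat -> bool :=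
  fun i => if i == j then v else b i.

(** The cell symbols seen as bit vectors: register [j] is written in unary on
    track [j], and track [W] marks cell 0, which the head cannot otherwise
    recognize when moving left. *)
Definition tracks (W : nat) (s : nat -> nat) (p : nat) : nat -> bool :=
  fun j => if j == W then p == 0 else p < s j.

(** Control states are pairs of a program address and one of four phases. *)
Definition track_conf (W pc ph p : nat) (T : nat -> nat -> bool) : config :=
  Config (4 * pc + ph) p (fun i => num (T i) W.+1).

(** The transition function on bit vectors. Phase 0 marks cell 0; it is entered
    only at the start. Phase 1 carries out the instruction: a branch looks at
    cell 0, the other instructions move right to the first cell beyond the
    register. Phase 2 erases the last cell of a register that is decremented;
    if the register is zero the head is still on cell 0, where there is nothing
    to erase. Phase 3 returns to the mark. Beyond the last instruction the mark
    is erased, and no transition leaves phase 2 there. *)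
Definition delta (W : nat) (P : seq instr) (pc ph : nat) (b : nat -> bool) :
    option (nat * nat * (nat -> bool) * dir) :=
  match ph, onth P pc with
  | 0, _ => Some (pc, 1, put b W true, Stay)
  | 1, Some (IInc j) =>
      if b j then Some (pc, 1, b, Right)
      else Some (pc, 3, put b j true, Stay)
  | 1, Some (IDec j) =>
      if b j then Some (pc, 1, b, Right) else Some (pc, 2, b, Left)
  | 1, Some (IBranch j l l') => Some (if b j then l' else l, 1, b, Stay)
  | 1, None => Some (pc, 2, put b W false, Stay)
  | 2, Some (IDec j) => Some (pc, 3, put b j false, Stay)
  | 3, _ => if b W then Some (pc.+1, 1, b, Stay) else Some (pc, 3, b, Left)
  | _, _ => None
  end.

Definition delta_rule (W : nat) (P : seq instr) (k : nat * nat * nat) :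
    option rule :=
  let: (pc, ph, a) := k in
  if delta W P pc ph (bit a) is Some (pc', ph', b, d) then
    Some (Rule (4 * pc + ph) a (4 * pc' + ph') (num b W.+1) d)
  else None.

(** [delta] tabulated on all symbols of [W.+1] bits. *)
Definition machine (W : nat) (P : seq instr) : seq rule :=
  pmap (delta_rule W P)
    [seq (x, a) |
       x <- [seq (pc, ph) | pc <- iota 0 (size P).+1, ph <- iota 0 4],
       a <- iota 0 (2 ^ W.+1)].

(** The key (address, phase, symbol) determines the rule, so that the first
    applicable rule is the tabulated one, whatever the order of the keys. *)
Lemma step_pmap W P xs pc ph a p t : ph < 4 -> t p = a ->
    all (fun k => k.1.2 < 4) xs ->
  step (pmap (delta_rule W P) xs) (Config (4 * pc + ph) p t) =
  if (pc, ph, a) \in xs then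
    if delta W P pc ph (bit a) is Some (pc', ph', b, d) then
      Some (Config (4 * pc' + ph') (move d p) (write t p (num b W.+1)))
    else None
  else None.
Proof.
move=> lt_ph ta; rewrite /step; elim: xs => [|[[pc1 ph1] a1] xs IHxs] //=.
move=> /andP [lt_ph1 /IHxs {}IHxs]; rewrite in_cons.
case: eqP => [[<- <- <-]|neq] /=.
  case: (delta _ _ _ _ _) IHxs => [[[[pc' ph'] b] d]|] /= IHxs.
    by rewrite /applies /= ta !eqxx.
  by rewrite IHxs; case: ifP.
case: (delta _ _ pc1 _ _) => [[[[pc' ph'] b] d]|] //=.
rewrite {1}/applies /= ta; case: ifP => //= /andP[/eqP E /eqP Ea].
by case: neq; congr (_, _, _); lia.
Qed.

Definition code_move (W : nat) (o : option (nat * nat * (nat -> bool) * dir)) :=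
  if o is Some (pc, ph, b, d) then Some (pc, ph, num b W.+1, d) else None.

Definition uses_regs (W : nat) (P : seq instr) : Prop :=
  forall pc a, onth P pc = Some a -> ireg a < W.

(** [delta] depends on the tracks up to [W] only, so nothing is lost in coding
    the bit vector [b] by a number. *)
Lemma delta_bit_num W P pc ph b : uses_regs W P ->
  code_move W (delta W P pc ph (bit (num b W.+1))) =
  code_move W (delta W P pc ph b).
Proof.
move=> wfP; have bitE i : i <= W -> bit (num b W.+1) i = b i.
  by move=> ?; rewrite bit_num.
have numE : num (bit (num b W.+1)) W.+1 = num b W.+1.
  exact/num_bit/num_lt.
have updE j v : num (put (bit (num b W.+1)) j v) W.+1 =
                num (put b j v) W.+1.
  by apply: eq_num => i lt_i; rewrite /put; case: eqP => // _; rewrite bitE.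
rewrite /delta; case E: (onth P pc) => [a|]; last first.
  case: ph => [|[|[|[|ph]]]] //=; rewrite ?updE ?bitE //.
  by case: ifP; rewrite /= numE.
have /ltnW := wfP _ _ E.
by case: a {E} ph => [j|j|j l l'] [|[|[|[|ph]]]] //= le_jW;
  rewrite ?bitE //; try case: ifP => _ /=; rewrite ?updE ?numE.
Qed.

Lemma step_machine W P pc ph p T pc' ph' b d :
    uses_regs W P -> pc <= size P -> ph < 4 ->
    delta W P pc ph (T p) = Some (pc', ph', b, d) ->
  step (machine W P) (track_conf W pc ph p T) =
  Some (track_conf W pc' ph' (move d p) (fun i => if i == p then b else T i)).
Proof.
move=> wfP le_pc lt_ph Ed; rewrite /track_conf.
have := delta_bit_num pc ph (T p) wfP; rewrite Ed.
rewrite (@step_pmap _ _ _ _ _ (num (T p) W.+1)) //; last first.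
  apply/allP => k /allpairsP[x [/allpairsP[y [_ y4 Ex]] _ ->]].
  by move: y4; rewrite mem_iota Ex.
rewrite ifT; last first.
  apply/allpairsP; exists (pc, ph, num (T p) W.+1); split=> //.
    by apply/allpairsP; exists (pc, ph); rewrite !mem_iota.
  by rewrite mem_iota num_lt.
case: (delta _ _ _ _ (bit _)) => [[[[pc1 ph1] b1] d1]|] //= [-> -> -> ->].
congr (Some (Config _ _ _)); apply: funext => i.
by rewrite /write; case: eqP.
Qed.

Lemma step_same W P pc ph p T pc' ph' d :
    uses_regs W P -> pc <= size P -> ph < 4 ->
    delta W P pc ph (T p) = Some (pc', ph', T p, d) ->
  step (machine W P) (track_conf W pc ph p T) =
  Some (track_conf W pc' ph' (move d p) T).
Proof.
move=> wfP le_pc lt_ph Ed; rewrite (step_machine _ _ _ Ed) //.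
by congr (Some (track_conf _ _ _ _ _)); apply: funext => i; case: eqP => [->|].
Qed.

Lemma reach_scan W P pc a s p : uses_regs W P -> pc <= size P ->
    onth P pc = Some a -> (a = IInc (ireg a) \/ a = IDec (ireg a)) ->
    p <= s (ireg a) ->
  reach (step (machine W P)) (track_conf W pc 1 0 (tracks W s))
    (track_conf W pc 1 p (tracks W s)).
Proof.
move=> wfP le_pc Ea Da; elim: p => [|p IHp] lt_p; first exact: reach_refl.
apply: reach_trans (IHp (ltnW lt_p)) _; apply: reach1.
have Tp : tracks W s p (ireg a).
  by rewrite /tracks; have := wfP _ _ Ea; case: eqP => // ->; rewrite ltnn.
rewrite (@step_same _ _ _ _ _ _ pc 1 Right) //.
by rewrite /delta Ea; case: Da Tp => -> /= ->.
Qed.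

Lemma reach_return W P pc p T : uses_regs W P -> pc <= size P ->
    (forall i, T i W = (i == 0)) ->
  reach (step (machine W P)) (track_conf W pc 3 p T) (track_conf W pc.+1 1 0 T).
Proof.
move=> wfP le_pc TW; elim: p => [|p IHp].
  by apply: reach1; rewrite (@step_same _ _ _ _ _ _ pc.+1 1 Stay) //= TW.
by apply: reach_step IHp; rewrite (@step_same _ _ _ _ _ _ pc 3 Left) //= TW.
Qed.

Lemma onth_size (T : Type) (s : seq T) i x : onth s i = Some x -> i < size s.
Proof. by elim: s i => [|y s IHs] [|i] //= /IHs. Qed.

(** One instruction, from the head on cell 0 to the head on cell 0. *)
Lemma reach_istep W P pc s pc' s' : uses_regs W P ->
    istep P (pc, s) = Some (pc', s') ->
  reach (step (machine W P)) (track_conf W pc 1 0 (tracks W s))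
    (track_conf W pc' 1 0 (tracks W s')).
Proof.
move=> wfP; rewrite /istep; case Ea: (onth P pc) => [a|//].
have ltj := wfP _ _ Ea; have /ltnW le_pc := onth_size Ea.
have neW : (ireg a == W) = false by apply/eqP; lia.
case Da: a Ea => [j|j|j l l'] Ea; rewrite {}Da /= in ltj neW *.
- move=> [<- <-].
  apply: reach_trans (@reach_scan _ _ _ _ s (s j) wfP le_pc Ea _ (leqnn _)) _.
    by left.
  apply: reach_step (step_machine (b := put (tracks W s (s j)) j true)
    (pc' := pc) (ph' := 3) (d := Stay) wfP le_pc _ _) _ => //.
    by rewrite /delta Ea {1}/tracks neW ltnn.
  set T := (X in track_conf _ _ 3 _ X).
  have -> : tracks W (write s j (s j).+1) = T.
    apply: funext => i; apply: funext => m; rewrite /T /tracks /put /write.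
    case: (m =P j) => [->|/eqP/negPf nej]; last first.
      by case: (i =P s j) => [->|] //=; rewrite nej.
    rewrite neW; case: (i =P s j) => [->|]; first by rewrite /= eqxx leqnn.
    by rewrite /= neW; lia.
  apply: reach_return => // i; rewrite /T /put /tracks.
  by case: (i =P s j) => [->|] /=; rewrite ?[W == j]eq_sym ?neW eqxx.
- move=> [<- <-].
  apply: reach_trans (@reach_scan _ _ _ _ s (s j) wfP le_pc Ea _ (leqnn _)) _.
    by right.
  apply: reach_step (@step_same _ _ _ _ _ _ pc 2 Left wfP le_pc _ _) _ => //.
    by rewrite /delta Ea {1}/tracks neW ltnn.
  apply: reach_step (step_machine (b := put (tracks W s (s j).-1) j false)
    (pc' := pc) (ph' := 3) (d := Stay) wfP le_pc _ _) _ => //.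
    by rewrite /delta Ea.
  set T := (X in track_conf _ _ 3 _ X).
  have -> : tracks W (write s j (s j).-1) = T.
    apply: funext => i; apply: funext => m; rewrite /T /tracks /put /write.
    case: (m =P j) => [->|/eqP/negPf nej]; last first.
      by case: (i =P (s j).-1) => [->|] //=; rewrite nej.
    rewrite neW; case: (i =P (s j).-1) => [->|]; first by rewrite /= eqxx ltnn.
    by rewrite /= neW; lia.
  apply: reach_return => // i; rewrite /T /put /tracks.
  by case: (i =P (s j).-1) => [->|] /=; rewrite ?[W == j]eq_sym ?neW eqxx.
- move=> [<- <-]; apply: reach1.
  rewrite (@step_same _ _ _ _ _ _ (if s j == 0 then l else l') 1 Stay) //.
  by rewrite /delta Ea {1}/tracks neW lt0n; case: eqP.
Qed.

Lemma reach_irun W P c c' : uses_regs W P -> reach (istep P) c c' ->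
  reach (step (machine W P)) (track_conf W c.1 1 0 (tracks W c.2))
    (track_conf W c'.1 1 0 (tracks W c'.2)).
Proof.
move=> wfP [n]; elim: n c => [|n IHn] c /=.
  by move=> ->; apply: reach_refl.
case E: (istep P c) => [c1|]; last by move=> ->; apply: reach_refl.
move=> /IHn; apply: reach_trans.
by case: c c1 E => pc s [pc1 s1] /(reach_istep wfP).
Qed.

Lemma compile_regs c p W : com_bound c <= W -> uses_regs W (compile c p).
Proof.
elim: c p => [|i|i|c IHc c' IHc'|i c IHc] p /=.
- by move=> _ [].
- by move=> lt_iW pc a /onth1P[_ <-].
- by move=> lt_iW pc a /onth1P[_ <-].
- rewrite geq_max => /andP[/IHc {}IHc /IHc' {}IHc'] pc a.
  by rewrite onth_cat; case: ifP => _ => [/IHc|/IHc'].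
- rewrite geq_max => /andP[lt_iW /IHc {}IHc] [|pc] a /=; first by case=> <-.
  rewrite -cats1 onth_cat; case: ifP => _ => [/IHc //|].
  by case/onth1P => _ <-.
Qed.

(** With all registers but the first equal to zero and the mark erased, the
    symbols are the digits of a unary numeral, as the conventions for input and
    output require. *)
Lemma computable_of_exec c W f : 0 < W -> com_bound c <= W ->
    (forall x, exists2 s, exec c (write (fun=> 0) 0 x) s &
       s 0 = f x /\ forall i, 0 < i < W -> s i = 0) ->
  computable f.
Proof.
move=> W_gt0 le_cW cP; set P := compile c 0.
have wfP : uses_regs W P := compile_regs le_cW.
have neW : (0 == W) = false by apply/eqP; lia.
have [e Ee] := TM_surj (machine W P).
exists e => x; rewrite Ee; have [s cxs [sf s0]] := cP x.
pose s_in := write (fun=> 0) 0 x.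
pose T i := if i == 0 then put (tracks W s 0) W false else tracks W s i.
exists (track_conf W (size P) 2 0 T); split; last first.
  have E i : num (T i) W.+1 = nat_of_bool (i < f x).
    rewrite numS; have -> : T i 0 = (i < f x).
      by rewrite /T /put /tracks; case: (i =P 0) => [->|] /=; rewrite neW sf.
    rewrite (_ : num _ _ = 0) ?addn0 // /num big1 // => j _.
    rewrite (_ : T i j.+1 = false) //; rewrite /T /put /tracks.
    have sj0 : j.+1 != W -> s j.+1 = 0.
      by move=> neq; rewrite s0 //; have := ltn_ord j; lia.
    by case: (i =P 0) => [_|/eqP/negPf nei] /=;
      case: (j.+1 =P W) sj0 => [//|_ ->].
  by split=> [i lt_i|] /=; rewrite E ?lt_i ?ltnn.
split.
  apply: reach_trans (_ : reach _ (track_conf W 0 1 0 (tracks W s_in)) _).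
    have -> : init x =
        track_conf W 0 0 0 (fun i => put (tracks W s_in i) W false).
      rewrite /init /track_conf; congr Config; apply: funext => i.
      rewrite numS /num big1 ?addn0 => [|j _].
        by rewrite /put /tracks /s_in /write neW.
      by rewrite /put /tracks /s_in /write /=; case: ifP => // ->.
    apply: reach1; rewrite (step_machine (pc' := 0) (ph' := 1)
      (b := put (put (tracks W s_in 0) W false) W true) (d := Stay)) //.
    congr (Some (track_conf _ _ _ _ _)); apply: funext => i; apply: funext => j.
    rewrite /put /tracks; case: (i =P 0) => [->|] /=.
      by case: eqP.
    by case: eqP.
  apply: reach_trans (_ : reach _ (track_conf W (size P) 1 0 (tracks W s)) _).
    have := compile_reach cxs [::] [::]; rewrite /= cats0.
    exact: reach_irun.
  apply: reach1; rewrite (step_machine (pc' := size P) (ph' := 2)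
      (b := put (tracks W s 0) W false) (d := Stay)) //.
  by rewrite /delta onth_default.
rewrite /machine (@step_pmap _ _ _ _ _ (num (T 0) W.+1)) //; last first.
  apply/allP => k /allpairsP[y [/allpairsP[z [_ z4 Ey]] _ ->]].
  by move: z4; rewrite mem_iota Ey.
by rewrite /delta onth_default //; case: ifP.
Qed.

(** * Recursive functions *)

(** The value of [f] on an environment depends on the variables below [m] only,
    and can be computed by a program that finds variable [i] in register [r i],
    puts the result into register [d] and preserves all other registers below
    [b]. The program must work for all choices of [r], [d] and [b], for this is
    what composition requires: arguments are computed into fresh registers.
    With environments as arguments the closure properties below apply to
    functions of any number of variables, and a bound variable is variable 0 of
    an environment shifted by one, as with de Bruijn indices. *)
Definition rec (m : nat) (f : (nat -> nat) -> nat) : Prop :=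
  (forall s s', (forall i, i < m -> s i = s' i) -> f s = f s') /\
  forall (r : nat -> nat) (d b : nat), (forall i, i < m -> r i < b) -> d < b ->
    exists c, forall s, exists2 s', exec c s s' &
      s' d = f (fun i => s (r i)) /\
      forall i, i < b -> i != d -> s' i = s i.

Definition scons (v : nat) (s : nat -> nat) (i : nat) : nat :=
  if i is i'.+1 then s i' else v.

(** The rule for loops that decrease their counter [i] by one. *)
Lemma exec_countdown i c (Q : nat -> (nat -> nat) -> Prop) n s :
    (forall n s, s i = n.+1 -> Q n.+1 s ->
       exists2 s', exec c s s' & s' i = n /\ Q n s') ->
    s i = n -> Q n s ->
  exists2 s', exec (While i c) s s' & s' i = 0 /\ Q 0 s'.
Proof.
move=> Hc; elim: n s => [|n IHn] s si Qs.
  by exists s => //; apply: ExecWhile0.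
have [s1 cs1 [s1i Qs1]] := Hc _ _ si Qs.
have [s2 ws2 Qs2] := IHn _ s1i Qs1.
by exists s2 => //; apply: ExecWhileS cs1 ws2; rewrite si.
Qed.

Definition clear (i : nat) : com := While i (Dec i).

Lemma exec_clear i s : exec (clear i) s (write s i 0).
Proof.
move En: (s i) => n; elim: n s En => [|n IHn] s si.
  rewrite (_ : write s i 0 = s); first exact: ExecWhile0.
  by apply: funext => j; rewrite /write; case: eqP => // ->.
apply: ExecWhileS (ExecDec _ _) _; first by rewrite si.
rewrite (_ : write s i 0 = write (write s i (s i).-1) i 0).
  by apply: IHn; rewrite /write eqxx si.
by apply: funext => j; rewrite /write; case: eqP.
Qed.

(* Case analysis on the coincidences between registers. *)
Ltac regs := rewrite /write; repeat (case: eqP => ? //); try lia.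

(** Copying uses register [b] as a buffer, from which [x] is restored. *)
Lemma exec_copy x d b : x < b -> d < b -> exists c, forall s,
  exists2 s', exec c s s' &
    s' d = s x /\ forall i, i < b -> i != d -> s' i = s i.
Proof.
move=> ltx ltd; case: (eqVneq x d) => [->|nexd].
  by exists Skip => s; exists s => //; apply: ExecSkip.
exists (Seq (clear b) (Seq (clear d)
  (Seq (While x (Seq (Dec x) (Seq (Inc b) (Inc d))))
       (While b (Seq (Dec b) (Inc x)))))) => s.
pose rest (s' : nat -> nat) :=
  forall i, i < b -> i != d -> i != x -> s' i = s i.
have [|||s1 cs1 [s1x [s1b s1d s1r]]] := @exec_countdown x
    (Seq (Dec x) (Seq (Inc b) (Inc d)))
    (fun n s' => [/\ s' b + n = s x, s' d = s' b & rest s'])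
    (s x) (write (write s b 0) d 0).
- move=> n s0 s0x [E1 E2 E3]; eexists.
    exact: ExecSeq (ExecDec _ _) (ExecSeq (ExecInc _ _) (ExecInc _ _)).
  split; first by regs.
  by split=> [||i * ]; [regs | regs | have := E3 i; regs].
- by regs.
- by split=> [||i *]; regs.
have [|||s2 cs2 [s2b [s2x s2d s2r]]] := @exec_countdown b (Seq (Dec b) (Inc x))
    (fun n s' => [/\ s' x + n = s x, s' d = s x & rest s']) (s x) s1.
- move=> n s0 s0b [E1 E2 E3]; eexists.
    exact: ExecSeq (ExecDec _ _) (ExecInc _ _).
  split; first by regs.
  by split=> [||i * ]; [regs | regs | have := E3 i; regs].
- by lia.
- by split=> //; lia.
exists s2; last first.
  by split=> // i lti nei; case: (eqVneq i x) => [->|]; [lia | exact: s2r].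
by apply: ExecSeq (exec_clear _ _) (ExecSeq (exec_clear _ _) (ExecSeq cs1 cs2)).
Qed.

Lemma rec_var m i : i < m -> rec m (fun s => s i).
Proof.
move=> lt_im; split=> [s s' -> //|r d b ltr ltd].
have [c cP] := exec_copy (ltr _ lt_im) ltd.
by exists c => s; have [s' cs' s'P] := cP s; exists s'.
Qed.

Lemma rec_zero m : rec m (fun=> 0).
Proof.
split=> // r d b _ _; exists (clear d) => s; exists (write s d 0).
  exact: exec_clear.
by split=> [|i _]; rewrite /write ?eqxx // => /negPf->.
Qed.

Lemma rec_succ m f : rec m f -> rec m (fun s => (f s).+1).
Proof.
move=> [locf Rf]; split=> [s s' /locf -> //|r d b ltr ltd].
have [c cP] := Rf r d b ltr ltd; exists (Seq c (Inc d)) => s.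
have [s' cs' [s'd s'P]] := cP s.
eexists; first exact: ExecSeq cs' (ExecInc _ _).
rewrite /write eqxx s'd; split=> // i lti nei.
by rewrite (negPf nei) s'P.
Qed.

(** The arguments are computed into the registers [b], ..., [b + n - 1], each
    one preserving those before it. *)
Lemma rec_subst n m f (g : nat -> (nat -> nat) -> nat) :
    rec n f -> (forall i, i < n -> rec m (g i)) ->
  rec m (fun s => f (fun i => g i s)).
Proof.
move=> [locf Rf] Rg; split=> [s s' eqs|r d b ltr ltd].
  by apply: locf => i /Rg[locg _]; apply: locg.
have args N : N <= n -> exists c, forall s, exists2 s', exec c s s' &
    (forall i, i < N -> s' (b + i) = g i (fun i => s (r i))) /\
    (forall i, i < b -> s' i = s i).
  elim: N => [_|N IHN ltN].
    by exists Skip => s; exists s => //; apply: ExecSkip.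
  have [c cP] := IHN (ltnW ltN); have [locg RgN] := Rg _ ltN.
  have [||c' c'P] := RgN r (b + N) (b + N).+1; [| by lia|].
    by move=> i /ltr; lia.
  exists (Seq c c') => s; have [s1 cs1 [s1g s1b]] := cP s.
  have [s2 cs2 [s2g s2b]] := c'P s1; exists s2; first exact: ExecSeq cs1 cs2.
  split=> [i|i lti]; last by rewrite s2b ?s1b; lia.
  rewrite ltnS leq_eqVlt => /predU1P[->|lti]; last by rewrite s2b ?s1g; lia.
  by rewrite s2g; apply: locg => j /ltr/s1b.
have [c cP] := args n (leqnn n).
have [|c' c'P] := Rf (addn b) d (b + n) _ (ltn_addr n ltd).
  by move=> i lti; rewrite ltn_add2l.
exists (Seq c c') => s; have [s1 cs1 [s1g s1b]] := cP s.
have [s2 cs2 [s2f s2b]] := c'P s1; exists s2; first exact: ExecSeq cs1 cs2.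
split; first by rewrite s2f; apply: locf.
by move=> i lti nei; rewrite s2b ?s1b // ltn_addr.
Qed.

Lemma rec_local_cons m (F : (nat -> nat) -> nat -> nat) s s' v :
    rec m.+1 (fun s => F (fun i => s i.+1) (s 0)) ->
  (forall i, i < m -> s i = s' i) -> F s v = F s' v.
Proof.
by move=> [locF _] eqs; apply: (locF (scons v s) (scons v s')) => -[|i] // /eqs.
Qed.

(** Unbounded search. The hypotheses say that [h s] is the least zero of [Q s];
    being given [h] avoids partial functions. *)
Lemma rec_min m (Q : (nat -> nat) -> nat -> nat) (h : (nat -> nat) -> nat) :
    rec m.+1 (fun s => Q (fun i => s i.+1) (s 0)) ->
    (forall s, Q s (h s) = 0) -> (forall s v, v < h s -> Q s v != 0) ->
  rec m h.
Proof.
move=> RQ Qh Qmin; have locQ := rec_local_cons _ RQ.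
have loch s s' : (forall i, i < m -> s i = s' i) -> h s = h s'.
  move=> eqs; apply/eqP; rewrite eqn_leq; apply/andP.
  split; rewrite leqNgt; apply/negP => /Qmin/eqP;
    [rewrite -(Qh s') | rewrite -(Qh s)].
    by apply; apply: locQ.
  by apply; apply: locQ => i /eqs.
split=> // r d b ltr ltd.
pose r' i := if i is i'.+1 then r i' else b.
have [||c cP] := RQ.2 r' b.+1 b.+2; [| by []|].
  by case=> //= i /ltr; lia.
have [|c' c'P] := @exec_copy b d b.+1 (leqnn _); first by lia.
exists (Seq (clear b) (Seq c (Seq (While b.+1 (Seq (Inc b) c)) c'))) => s.
pose e i := s (r i).
have loop n s1 : s1 b + n = h e -> s1 b.+1 = Q e (s1 b) ->
    (forall i, i < b -> s1 i = s i) ->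
    exists2 s2, exec (While b.+1 (Seq (Inc b) c)) s1 s2 &
      s2 b = h e /\ forall i, i < b -> s2 i = s i.
  elim: n s1 => [|n IHn] s1 s1b s1f s1r.
    rewrite addn0 in s1b; exists s1 => //.
    by apply: ExecWhile0; rewrite s1f s1b Qh.
  have /Qmin/eqP Qn0 : s1 b < h e by lia.
  have [s2 cs2 [s2f s2r]] := cP (write s1 b (s1 b).+1).
  have s2b : s2 b = (s1 b).+1 by rewrite s2r /write ?eqxx //; lia.
  have s2r' i : i < b -> s2 i = s i.
    by move=> lti; rewrite s2r ?/write; [regs; rewrite s1r | lia | lia].
  have [|||s3 ws3 s3P] := IHn s2 => //; first by lia.
    rewrite s2f s2b /write /= eqxx; apply: locQ => i /ltr lti.
    by regs; rewrite s1r.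
  exists s3 => //; apply: ExecWhileS ws3; first by rewrite s1f.
  exact: ExecSeq (ExecInc _ _) cs2.
have [s1 cs1 [s1f s1r]] := cP (write s b 0).
have s1r' i : i < b -> s1 i = s i.
  by move=> lti; rewrite s1r ?/write; [regs | lia | lia].
have s1b : s1 b = 0 by rewrite s1r /write ?eqxx //; lia.
have [|||s2 ws2 [s2b s2r]] := loop (h e) s1 => //; first by lia.
  rewrite s1f s1b /write /= eqxx; apply: locQ => i /ltr lti.
  by regs.
have [s3 cs3 [s3d s3r]] := c'P s2; exists s3.
  exact: ExecSeq (exec_clear _ _) (ExecSeq cs1 (ExecSeq ws2 cs3)).
by split=> [|i lti nei]; [rewrite s3d | rewrite s3r ?s2r // ltnS ltnW].
Qed.

(** Primitive recursion: register [b] counts down, [b.+1] holds the index and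
    [b.+2] the current value. *)
Lemma rec_iteri m N A (F : (nat -> nat) -> nat -> nat -> nat) :
    rec m N -> rec m A ->
    rec m.+2 (fun s => F (fun i => s i.+2) (s 0) (s 1)) ->
  rec m (fun s => iteri (N s) (F s) (A s)).
Proof.
move=> [locN RN] [locA RA] [locF RF].
have {}locF s s' i v : (forall i, i < m -> s i = s' i) -> F s i v = F s' i v.
  move=> eqs; apply: (locF (scons i (scons v s)) (scons i (scons v s'))).
  by move=> [|[|j]] // /eqs.
split=> [s s' eqs|r d b ltr ltd].
  rewrite (locN _ _ eqs) (locA _ _ eqs); elim: (N s') => //= n ->.
  exact: locF.
have [||cN cNP] := RN r b b.+1; [by move=> i /ltr/ltnW | by [] |].
have [||cA cAP] := RA r b.+2 b.+3; [by move=> i /ltr; lia | by [] |].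
pose r' i := match i with 0 => b.+1 | 1 => b.+2 | i'.+2 => r i' end.
have [||cF cFP] := RF r' b.+2 b.+3; [| by [] |].
  by move=> [|[|i]] //= /ltr; lia.
have [||cC cCP] := @exec_copy b.+2 d b.+3; [by [] | by lia |].
exists (Seq cN (Seq cA (Seq (clear b.+1)
  (Seq (While b (Seq (Dec b) (Seq cF (Inc b.+1)))) cC)))) => s.
pose e i := s (r i).
have [s1 cs1 [s1b s1r]] := cNP s; have [s2 cs2 [s2a s2r]] := cAP s1.
have s1r' i : i < b -> s1 i = s i by move=> lti; rewrite s1r; lia.
have s2r' i : i < b -> s2 i = s i by move=> lti; rewrite s2r ?s1r'; lia.
pose inv n s' := [/\ s' b.+1 + n = N e, s' b.+2 = iteri (s' b.+1) (F e) (A e)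
                  & forall i, i < b -> s' i = s i].
have [|||s3 cs3 [_ [s3i s3v s3r]]] := @exec_countdown b
    (Seq (Dec b) (Seq cF (Inc b.+1))) inv (N e) (write s2 b.+1 0).
- move=> n s4 s4b [s4i s4v s4r].
  have [s5 cs5 [s5v s5r]] := cFP (write s4 b (s4 b).-1).
  have s5i : s5 b.+1 = s4 b.+1 by rewrite s5r; [regs | lia | lia].
  have s5b : s5 b = n by rewrite s5r; [regs | lia | lia].
  have s5r' i : i < b -> s5 i = s i.
    by move=> lti; rewrite s5r; [regs; rewrite s4r | lia | lia].
  exists (write s5 b.+1 (s5 b.+1).+1).
    exact: ExecSeq (ExecDec _ _) (ExecSeq cs5 (ExecInc _ _)).
  split; first by regs.
  split; [by regs| |by move=> i /[dup] lti /s5r'; regs].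
  rewrite /write eqxx (_ : (b.+2 == b.+1) = false); last by apply/eqP; lia.
  rewrite s5v s5i /= /write (_ : (b.+1 == b) = false); last by apply/eqP; lia.
  rewrite (_ : (b.+2 == b) = false); last by apply/eqP; lia.
  by rewrite s4v; apply: locF => i /ltr lti; regs; rewrite s4r.
- by rewrite /write; regs; rewrite s2r; [rewrite s1b | lia | lia].
- split; [by regs | | by move=> i /[dup] lti /s2r'; regs].
  rewrite /write eqxx (_ : (b.+2 == b.+1) = false); last by apply/eqP; lia.
  by rewrite s2a; apply: locA => i /ltr/s1r'.
have [s4 cs4 [s4d s4r]] := cCP s3; exists s4.
  apply: ExecSeq cs1 (ExecSeq cs2 _).
  exact: ExecSeq (exec_clear _ _) (ExecSeq cs3 cs4).
split; first by rewrite s4d s3v; move: s3i; rewrite addn0 => ->.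
by move=> i lti nei; rewrite s4r ?s3r //; lia.
Qed.

(** The registers used for intermediate results are cleared at the end, since
    they share the tape with the output. *)
Lemma computable_of_rec f : rec 1 (fun s => f (s 0)) -> computable f.
Proof.
move=> [_ Rf]; have [||c cP] := Rf id 0 1 => //.
pose W := (com_bound c).+1.
pose zeros := foldr (fun i => Seq (clear i)) Skip (iota 1 (com_bound c)).
have zP s : exists2 s', exec zeros s s' &
    s' 0 = s 0 /\ forall i, 0 < i < W -> s' i = 0.
  have [s' zs' s'P] : exists2 s', exec zeros s s' & forall i, s' i =
      if i \in iota 1 (com_bound c) then 0 else s i.
    rewrite /zeros; elim: (iota _ _) s => [|j l IHl] s /=.
      by exists s => //; apply: ExecSkip.
    have [s' ls' s'P] := IHl (write s j 0); exists s'.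
      exact: ExecSeq (exec_clear _ _) ls'.
    move=> i; rewrite s'P in_cons /write; case: (i =P j) => //=.
    by case: ifP.
  exists s' => //; split=> [|i lti]; rewrite s'P mem_iota //.
  by rewrite (_ : _ && _ = true) //; move: lti; rewrite /W; lia.
apply: (@computable_of_exec (Seq c zeros) W) => //=.
  rewrite geq_max leqnSn /= /zeros.
  have: all (fun i => i < W) (iota 1 (com_bound c)).
    by apply/allP => i; rewrite mem_iota /W; lia.
  elim: (iota _ _) => //= i l IHl /andP[lti /IHl lel].
  by rewrite !geq_max lti lel.
move=> x; have [s cs [sf _]] := cP (write (fun=> 0) 0 x).
have [s' zs' [s'0 s'P]] := zP s; exists s'; first exact: ExecSeq cs zs'.
by rewrite s'0 sf.
Qed.

(** * Arithmetic *)
Create HintDb rec discriminated.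
(* Unfolding constants would make the wrong closure lemmas apply. *)
#[local] Hint Constants Opaque : rec.

Lemma rec_const m c : rec m (fun=> c).
Proof. by elim: c => [|c IHc]; [apply: rec_zero | apply: rec_succ]. Qed.

Lemma rec_rename n m (r : nat -> nat) f : rec n f ->
  (forall i, i < n -> r i < m) -> rec m (fun s => f (fun i => s (r i))).
Proof. by move=> Rf lt_r; apply: rec_subst Rf _ => i /lt_r; apply: rec_var. Qed.

Lemma rec_comp1 m F f :
  rec 1 (fun s => F (s 0)) -> rec m f -> rec m (fun s => F (f s)).
Proof. by move=> RF Rf; apply: (rec_subst (g := fun=> f) RF) => -[]. Qed.

Lemma rec_comp2 m F f g : rec 2 (fun s => F (s 0) (s 1)) ->
  rec m f -> rec m g -> rec m (fun s => F (f s) (g s)).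
Proof.
move=> RF Rf Rg; apply: (rec_subst (g := fun i => nth f [:: f; g] i) RF).
by case=> [|[]].
Qed.

Lemma rec_comp3 m F f g h : rec 3 (fun s => F (s 0) (s 1) (s 2)) ->
  rec m f -> rec m g -> rec m h -> rec m (fun s => F (f s) (g s) (h s)).
Proof.
move=> RF Rf Rg Rh; apply: (rec_subst (g := fun i => nth f [:: f; g; h] i) RF).
by case=> [|[|[]]].
Qed.

Lemma rec_ext m f g : f =1 g -> rec m f -> rec m g.
Proof. by move=> /funext->. Qed.

#[local] Hint Resolve rec_const rec_succ : rec.
#[local] Hint Extern 1 (rec _ (fun s => s _)) =>
  (apply: rec_var; reflexivity) : rec.
Ltac solve_rec := cbv beta; eauto 60 with rec nocore.

Lemma rec_addn m f g : rec m f -> rec m g -> rec m (fun s => f s + g s).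
Proof.
apply: rec_comp2.
apply: (@rec_ext _ (fun s => iteri (s 0) (fun _ v => v.+1) (s 1))).
  by move=> s; elim: (s 0) => //= n ->.
by apply: rec_iteri; solve_rec.
Qed.
#[local] Hint Resolve rec_addn : rec.

Lemma rec_muln m f g : rec m f -> rec m g -> rec m (fun s => f s * g s).
Proof.
apply: rec_comp2.
apply: (@rec_ext _ (fun s => iteri (s 0) (fun _ v => s 1 + v) 0)).
  by move=> s; elim: (s 0) => //= n ->; rewrite mulSn.
by apply: (rec_iteri (F := fun s _ v => s 1 + v)); solve_rec.
Qed.
#[local] Hint Resolve rec_muln : rec.

Lemma rec_predn m f : rec m f -> rec m (fun s => (f s).-1).
Proof.
apply: rec_comp1; apply: (@rec_ext _ (fun s => iteri (s 0) (fun i _ => i) 0)).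
  by move=> s; case: (s 0).
by apply: rec_iteri; solve_rec.
Qed.
#[local] Hint Resolve rec_predn : rec.

Lemma rec_subn m f g : rec m f -> rec m g -> rec m (fun s => f s - g s).
Proof.
apply: rec_comp2.
apply: (@rec_ext _ (fun s => iteri (s 1) (fun _ v => v.-1) (s 0))).
  by move=> s; elim: (s 1) => [|n /= ->]; rewrite ?subn0 ?subnS.
by apply: rec_iteri; solve_rec.
Qed.
#[local] Hint Resolve rec_subn : rec.

Lemma rec_expn m f g : rec m f -> rec m g -> rec m (fun s => f s ^ g s).
Proof.
apply: rec_comp2.
apply: (@rec_ext _ (fun s => iteri (s 1) (fun _ v => s 0 * v) 1)).
  by move=> s; elim: (s 1) => //= n ->; rewrite expnS.
by apply: (rec_iteri (F := fun s _ v => s 0 * v)); solve_rec.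
Qed.
#[local] Hint Resolve rec_expn : rec.

Lemma rec_neg m (b : (nat -> nat) -> bool) :
  rec m (fun s => b s) -> rec m (fun s => ~~ b s).
Proof.
move=> Rb; apply: (@rec_ext _ (fun s => 1 - b s)); last by solve_rec.
by move=> s; case: (b s).
Qed.
#[local] Hint Resolve rec_neg : rec.

Lemma rec_leq m f g : rec m f -> rec m g -> rec m (fun s => f s <= g s).
Proof.
move=> Rf Rg; apply: (@rec_ext _ (fun s => 1 - (f s - g s))); last by solve_rec.
by move=> s; lia.
Qed.
#[local] Hint Resolve rec_leq : rec.

Lemma rec_and m (b c : (nat -> nat) -> bool) :
  rec m (fun s => b s) -> rec m (fun s => c s) -> rec m (fun s => b s && c s).
Proof.
move=> Rb Rc; apply: (@rec_ext _ (fun s => b s * c s)); last by solve_rec.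
by move=> s; rewrite mulnb.
Qed.
#[local] Hint Resolve rec_and : rec.

Lemma rec_eq m (f g : (nat -> nat) -> nat) :
  rec m f -> rec m g -> rec m (fun s => f s == g s).
Proof.
move=> Rf Rg; apply: (@rec_ext _ (fun s => (f s <= g s) && (g s <= f s))).
  by move=> s; rewrite -eqn_leq.
by solve_rec.
Qed.
#[local] Hint Resolve rec_eq : rec.

Lemma rec_if m (b : (nat -> nat) -> bool) f g : rec m (fun s => b s) ->
  rec m f -> rec m g -> rec m (fun s => if b s then f s else g s).
Proof.
move=> Rb Rf Rg; apply: (@rec_ext _ (fun s => b s * f s + ~~ b s * g s)).
  by move=> s; case: (b s); rewrite /= ?mul1n ?mul0n ?addn0.
by solve_rec.
Qed.
#[local] Hint Resolve rec_if : rec.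

Lemma rec_addb m (b c : (nat -> nat) -> bool) :
  rec m (fun s => b s) -> rec m (fun s => c s) -> rec m (fun s => b s (+) c s).
Proof.
move=> Rb Rc.
apply: (@rec_ext _ (fun s => if b s then nat_of_bool (~~ c s) else c s)).
  by move=> s; case: (b s).
by solve_rec.
Qed.
#[local] Hint Resolve rec_addb : rec.

Lemma rec_sum m f (F : (nat -> nat) -> nat -> nat) :
    rec m f -> rec m.+1 (fun s => F (fun i => s i.+1) (s 0)) ->
  rec m (fun s => \sum_(i < f s) F s i).
Proof.
move=> Rf RF.
apply: (@rec_ext _ (fun s => iteri (f s) (fun i v => v + F s i) 0)).
  move=> s; elim: (f s) => [|n /= ->]; first by rewrite big_ord0.
  by rewrite big_ord_recr.
apply: (rec_iteri (F := fun s i v => v + F s i)); solve_rec.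
apply: rec_addn; solve_rec.
apply: (rec_rename (r := fun i => if i is i'.+1 then i'.+2 else 0) RF).
by case.
Qed.

Lemma rec_iter m f (F : (nat -> nat) -> nat -> nat) A :
    rec m f -> rec m A -> rec m.+1 (fun s => F (fun i => s i.+1) (s 0)) ->
  rec m (fun s => iter (f s) (F s) (A s)).
Proof.
move=> Rf RA RF.
apply: (@rec_ext _ (fun s => iteri (f s) (fun _ v => F s v) (A s))).
  by move=> s; elim: (f s) => //= n ->.
apply: (rec_iteri (F := fun s _ v => F s v)) => //.
by apply: (rec_rename (r := fun i => i.+1) RF).
Qed.

Lemma rec_odd m f : rec m f -> rec m (fun s => odd (f s)).
Proof.
apply: (rec_comp1 (F := fun x => odd x)).
apply: (@rec_ext _ (fun s => iter (s 0) (fun v => 1 - v) 0)).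
  by move=> s; elim: (s 0) => //= n ->; case: (odd n).
by apply: rec_iter; solve_rec.
Qed.
#[local] Hint Resolve rec_odd : rec.

(** Reduces division to a sum of tests, which [rec_sum] handles. *)
Lemma divn_sum x d : 0 < d -> x %/ d = \sum_(i < x) (i.+1 * d <= x).
Proof.
move=> d_gt0; transitivity (\sum_(i < x) (i < x %/ d)).
  have: x %/ d <= x by apply: leq_div.
  move: (x %/ d) => q; elim: x => [|n IHn]; first by rewrite big_ord0; lia.
  rewrite big_ord_recr /= leq_eqVlt => /predU1P[->|/[dup] ? /IHn <-]; last lia.
  rewrite ltnSn (eq_bigr (fun=> 1)) ?sum1_card ?card_ord ?addn1 // => i _.
  by rewrite ltnW // ltnS.
by apply: eq_bigr => i _; rewrite leq_divRL.
Qed.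

Lemma rec_bit m f g : rec m f -> rec m g -> rec m (fun s => bit (f s) (g s)).
Proof.
apply: (rec_comp2 (F := fun x y => bit x y)).
apply: (@rec_ext _ (fun s => odd (\sum_(j < s 0) (j.+1 * 2 ^ s 1 <= s 0)))).
  by move=> s; rewrite /bit divn_sum // expn_gt0.
apply: rec_odd.
by apply: (rec_sum (F := fun s j => j.+1 * 2 ^ s 1 <= s 0)); solve_rec.
Qed.
#[local] Hint Resolve rec_bit : rec.

Lemma rec_pair_code m f g :
  rec m f -> rec m g -> rec m (fun s => pair_code (f s) (g s)).
Proof.
apply: rec_comp2.
apply: (@rec_ext _ (fun s => s 1 + iteri (s 1 + s 0) (fun i v => i.+1 + v) 0)).
  by move=> s; rewrite /pair_code /Cantor.to_nat.
by apply: rec_addn; [solve_rec | apply: rec_iteri; solve_rec].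
Qed.
#[local] Hint Resolve rec_pair_code : rec.

Definition code_fst (n : nat) : nat := (Cantor.of_nat n).1.

Definition code_snd (n : nat) : nat := (Cantor.of_nat n).2.

Lemma code_fstK x y : code_fst (pair_code x y) = x.
Proof. by rewrite /code_fst /pair_code Cantor.cancel_of_to. Qed.

Lemma code_sndK x y : code_snd (pair_code x y) = y.
Proof. by rewrite /code_snd /pair_code Cantor.cancel_of_to. Qed.

Lemma pair_codeK n : pair_code (code_fst n) (code_snd n) = n.
Proof.
rewrite /pair_code /code_fst /code_snd -surjective_pairing.
exact: Cantor.cancel_to_of.
Qed.

(** The inverse of the pairing function is obtained by summing over all pairs
    of numbers up to [n]; only the pair coded by [n] contributes. *)
Lemma sum_code n (F : nat -> nat -> nat) :
  \sum_(x < n.+1) \sum_(y < n.+1) (pair_code x y == n) * F x y =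
  F (code_fst n) (code_snd n).
Proof.
have /leP := Cantor.to_nat_non_decreasing (code_fst n) (code_snd n).
rewrite -/(pair_code _ _) pair_codeK => le_n.
have lex : code_fst n < n.+1 by move: le_n; rewrite plusE; lia.
have ley : code_snd n < n.+1 by move: le_n; rewrite plusE; lia.
rewrite (bigD1 (Ordinal lex)) //= (bigD1 (Ordinal ley)) //= pair_codeK eqxx.
rewrite mul1n !big1 ?addn0 // => [x nex|y ney].
  rewrite big1 // => y _; case: eqP => // E.
  by case/eqP: nex; apply/val_inj; move/(congr1 code_fst): E; rewrite code_fstK.
case: eqP => // E.
by case/eqP: ney; apply: val_inj; move/(congr1 code_snd): E; rewrite code_sndK.
Qed.

Lemma rec_code_fst m f : rec m f -> rec m (fun s => code_fst (f s)).
Proof.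
apply: rec_comp1.
apply: (@rec_ext _ (fun s => \sum_(x < (s 0).+1) \sum_(y < (s 0).+1)
                                (pair_code x y == s 0) * x)).
  by move=> s; apply: (sum_code (s 0) (fun x _ => x)).
apply: (rec_sum (F := fun s x =>
  \sum_(y < (s 0).+1) (pair_code x y == s 0) * x)).
  by solve_rec.
by apply: (rec_sum (F := fun s y => (pair_code (s 0) y == s 1) * s 0));
  solve_rec.
Qed.

Lemma rec_code_snd m f : rec m f -> rec m (fun s => code_snd (f s)).
Proof.
apply: rec_comp1.
apply: (@rec_ext _ (fun s => \sum_(x < (s 0).+1) \sum_(y < (s 0).+1)
                                (pair_code x y == s 0) * y)).
  by move=> s; apply: (sum_code (s 0) (fun _ y => y)).
apply: (rec_sum (F := fun s x =>
  \sum_(y < (s 0).+1) (pair_code x y == s 0) * y)).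
  by solve_rec.
by apply: (rec_sum (F := fun s y => (pair_code (s 0) y == s 1) * y)); solve_rec.
Qed.
#[local] Hint Resolve rec_code_fst rec_code_snd : rec.

(** * Coded lists *)

(** These satisfy [code_hd 0 = 0] and [code_tl 0 = 0]: an exhausted list behaves
    like the blank part of a tape. *)
Definition code_hd (n : nat) : nat := code_fst n.-1.

Definition code_tl (n : nat) : nat := code_snd n.-1.

Definition code_cons (x n : nat) : nat := (pair_code x n).+1.

Definition code_nth (n i : nat) : nat := code_hd (iter i code_tl n).

Lemma code_hdE s : code_hd (seq_code s) = head 0 s.
Proof. by case: s => [|x s] //; rewrite /code_hd /= code_fstK. Qed.

Lemma code_tlE s : code_tl (seq_code s) = seq_code (behead s).
Proof. by case: s => [|x s] //; rewrite /code_tl /= code_sndK. Qed.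

Lemma code_nthE s i : code_nth (seq_code s) i = nth 0 s i.
Proof.
rewrite /code_nth; elim: i s => [|i IHi] s; first by rewrite /= code_hdE nth0.
by rewrite iterSr code_tlE IHi nth_behead.
Qed.

Lemma size_seq_code s : size s <= seq_code s.
Proof.
elim: s => //= x s /leq_trans; apply.
have /leP := Cantor.to_nat_non_decreasing x (seq_code s).
exact/leq_trans/leq_addr.
Qed.

Lemma seq_decodeK n : seq_code (seq_decode n) = n.
Proof.
suff [s <-] : exists s, seq_code s = n by rewrite seq_codeK.
elim/ltn_ind: n => -[|n] IHn; first by exists [::].
have [|s Es] := IHn (code_snd n).
  have /leP := Cantor.to_nat_non_decreasing (code_fst n) (code_snd n).
  by rewrite -/(pair_code _ _) pair_codeK; lia.
by exists (code_fst n :: s); rewrite /= Es pair_codeK.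
Qed.

Lemma rec_code_hd m f : rec m f -> rec m (fun s => code_hd (f s)).
Proof. by rewrite /code_hd; solve_rec. Qed.

Lemma rec_code_tl m f : rec m f -> rec m (fun s => code_tl (f s)).
Proof. by rewrite /code_tl; solve_rec. Qed.

Lemma rec_code_cons m f g :
  rec m f -> rec m g -> rec m (fun s => code_cons (f s) (g s)).
Proof. by rewrite /code_cons; solve_rec. Qed.
#[local] Hint Resolve rec_code_hd rec_code_tl rec_code_cons : rec.

Lemma rec_code_nth m f g :
  rec m f -> rec m g -> rec m (fun s => code_nth (f s) (g s)).
Proof.
apply: rec_comp2; apply: rec_code_hd.
by apply: (rec_iter (F := fun _ => code_tl)); solve_rec.
Qed.
#[local] Hint Resolve rec_code_nth : rec.

(** * Simulating Turing machines *)

Definition code_applies (q a r : nat) : bool :=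
  (code_fst r == q) && (code_fst (code_snd r) == a).

(** Deletes rules from the coded table [e] up to the first one that applies;
    the result is 0 if no rule does. As a list is no longer than its code, [e]
    iterations are enough. *)
Definition code_find (e q a : nat) : nat :=
  iter e (fun v => if (v != 0) && ~~ code_applies q a (code_hd v) then code_tl v
                   else v) e.

Lemma iter_fixpoint (T : Type) (F : T -> T) k x : F x = x -> iter k F x = x.
Proof. by move=> Fx; elim: k => //= k ->. Qed.

Lemma code_findE q a s : code_find (seq_code s) q a =
  seq_code (drop (find (code_applies q a) s) s).
Proof.
rewrite /code_find; set F := (X in iter _ X _).
suff H k : size s <= k ->
    iter k F (seq_code s) = seq_code (drop (find (code_applies q a) s) s).
  exact/H/size_seq_code.
elim: s k => [|x s IHs] k; first by move=> _; rewrite iter_fixpoint.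
have FE : F (seq_code (x :: s)) =
    if code_applies q a x then seq_code (x :: s) else seq_code s.
  by rewrite /F code_hdE code_tlE /=; case: (code_applies q a x).
move: FE; rewrite [find _ _]/=; case: (code_applies q a x) => FE.
  by rewrite iter_fixpoint.
by case: k => // k le_sk; rewrite iterSr FE IHs.
Qed.

(** [l] codes the tape to the left of the head, nearest cell first, and [r] the
    tape from the head on. *)
Definition code_config (q l r : nat) : nat := pair_code q (pair_code l r).

Definition code_rule (e c : nat) : nat :=
  code_find e (code_fst c) (code_hd (code_snd (code_snd c))).

(** Like [run], leaves the configuration of a halted machine unchanged. *)
Definition code_step (e c : nat) : nat :=
  let l := code_fst (code_snd c) in
  let r := code_snd (code_snd c) in
  let v := code_rule e c in
  let q' := code_fst (code_snd (code_snd (code_hd v))) in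
  let w := code_fst (code_snd (code_snd (code_snd (code_hd v)))) in
  let d := code_snd (code_snd (code_snd (code_snd (code_hd v)))) in
  if v == 0 then c
  else if d == 0 then
    if l == 0 then code_config q' l (code_cons w (code_tl r))
    else code_config q' (code_tl l)
           (code_cons (code_hd l) (code_cons w (code_tl r)))
  else if d == 1 then code_config q' (code_cons w l) (code_tl r)
  else code_config q' l (code_cons w (code_tl r)).

Definition code_run (e x t : nat) : nat :=
  iter t (code_step e) (code_config 0 0 (iter x (code_cons 1) 0)).

Definition code_halted (e x t : nat) : bool :=
  code_rule e (code_run e x t) == 0.

Lemma rec_code_rule m f g :
  rec m f -> rec m g -> rec m (fun s => code_rule (f s) (g s)).
Proof.
apply: rec_comp2; rewrite /code_rule /code_find /code_applies.
by apply: (rec_iter (F := fun s v =>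
  if (v != 0) && ~~ ((code_fst (code_hd v) == code_fst (s 1)) &&
      (code_fst (code_snd (code_hd v)) == code_hd (code_snd (code_snd (s 1)))))
  then code_tl v else v)); solve_rec.
Qed.
#[local] Hint Resolve rec_code_rule : rec.

Lemma rec_code_run m f g h : rec m f -> rec m g -> rec m h ->
  rec m (fun s => code_run (f s) (g s) (h s)).
Proof.
apply: rec_comp3; rewrite /code_run.
apply: (rec_iter (F := fun s => code_step (s 0))); first by solve_rec.
  rewrite /code_config; apply: rec_pair_code; first by solve_rec.
  apply: rec_pair_code; first by solve_rec.
  by apply: (rec_iter (F := fun s => code_cons 1)); solve_rec.
rewrite /code_step /code_config; cbv zeta; cbv beta.
by do 3 (try apply: rec_if); solve_rec.
Qed.
#[local] Hint Resolve rec_code_run : rec.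

Lemma rec_code_halted m f g h : rec m f -> rec m g -> rec m h ->
  rec m (fun s => code_halted (f s) (g s) (h s)).
Proof. by rewrite /code_halted; solve_rec. Qed.
#[local] Hint Resolve rec_code_halted : rec.

(** [catrev l r] is the tape as a list from cell 0. *)
Definition encodes (c : nat) (C : config) : Prop :=
  exists l r, [/\ c = code_config (c_state C) (seq_code l) (seq_code r),
    size l = c_head C & forall i, c_tape C i = nth 0 (catrev l r) i].

Lemma rule_decodeE n : rule_decode n =
  Rule (code_fst n) (code_fst (code_snd n)) (code_fst (code_snd (code_snd n)))
    (code_fst (code_snd (code_snd (code_snd n))))
    (dir_decode (code_snd (code_snd (code_snd (code_snd n))))).
Proof.
rewrite /rule_decode /code_fst /code_snd.
by case: (Cantor.of_nat n) => q n1 /=; case: (Cantor.of_nat n1) => a n2 /=;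
  case: (Cantor.of_nat n2) => q' n3 /=; case: (Cantor.of_nat n3).
Qed.

Lemma step_drop s C : step (map rule_decode s) C =
  if drop (find (code_applies (c_state C) (c_tape C (c_head C))) s) s is r :: _
  then Some (Config (r_next (rule_decode r))
                 (move (r_move (rule_decode r)) (c_head C))
                 (write (c_tape C) (c_head C) (r_write (rule_decode r))))
  else None.
Proof.
rewrite /step; elim: s => //= r s IHs.
have -> : applies C (rule_decode r) =
    code_applies (c_state C) (c_tape C (c_head C)) r by rewrite rule_decodeE.
by case: (code_applies _ _ r).
Qed.

Lemma nth_catrev_write l w r i :
  nth 0 (catrev l (w :: behead r)) i =
  write (nth 0 (catrev l r)) (size l) w i.
Proof.
rewrite /write !catrevE !nth_cat size_rev.
case: ltngtP => // [gt_il|->]; last by rewrite subnn.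
by rewrite -[i - size l]prednK ?subn_gt0 //= nth_behead.
Qed.

Lemma code_ruleE e c C : encodes c C -> exists l r,
  [/\ c = code_config (c_state C) (seq_code l) (seq_code r),
    size l = c_head C, (forall i, c_tape C i = nth 0 (catrev l r) i),
    c_tape C (c_head C) = head 0 r &
    code_rule e c = seq_code (drop (find (code_applies (c_state C)
       (c_tape C (c_head C))) (seq_decode e)) (seq_decode e))].
Proof.
move=> [l [r [Ec El Et]]]; exists l, r.
have Er : c_tape C (c_head C) = head 0 r.
  by rewrite Et -El catrevE nth_cat size_rev ltnn subnn nth0.
split=> //; rewrite /code_rule Ec /code_config !code_fstK !code_sndK code_hdE.
by rewrite -[in LHS](seq_decodeK e) code_findE Er.
Qed.

Lemma code_ruleP e c C : encodes c C ->
  (code_rule e c == 0) = ~~ isSome (step (TM e) C).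
Proof.
move=> /(code_ruleE e)[l [r [_ _ _ _ ->]]].
by rewrite step_drop; case: (drop _ _).
Qed.

Lemma code_stepP e c C C' : encodes c C -> step (TM e) C = Some C' ->
  encodes (code_step e c) C'.
Proof.
move=> /(code_ruleE e)[l [r [Ec El Et Ea Er]]]; rewrite step_drop.
case Ed: (drop _ _) => [|v vs] // [<-]; rewrite Ed in Er.
have Ehd : code_hd (code_rule e c) = v by rewrite Er code_hdE.
have Enz : (code_rule e c == 0) = false by rewrite Er.
have El' : (seq_code l == 0) = (size l == 0) by case: l {El Et Ec}.
rewrite /code_step Enz Ehd; move: Ec El'; rewrite /code_config => -> El'.
rewrite rule_decodeE /= !(code_fstK, code_sndK).
set q' := code_fst (code_snd (code_snd v)).
set w := code_fst (code_snd (code_snd (code_snd v))).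
have Ew : code_cons w (code_tl (seq_code r)) = seq_code (w :: behead r).
  by rewrite code_tlE.
have Et' i : write (c_tape C) (c_head C) w i =
    nth 0 (catrev l (w :: behead r)) i.
  by rewrite nth_catrev_write El /write Et.
rewrite Ew code_hdE !code_tlE.
case: (code_snd (code_snd (code_snd (code_snd v)))) => [|[|d]] /=.
- case: l El El' Et' {Et} => [|x l] /= El El' Et'.
    by exists [::], (w :: behead r); split=> //=; rewrite -El.
  by exists l, (x :: w :: behead r); split=> //=; rewrite -El.
- by exists (w :: l), (behead r); split=> //=; rewrite El.
- by exists l, (w :: behead r); split=> //=; rewrite El.
Qed.

Lemma code_runP e x t : encodes (code_run e x t) (run (step (TM e)) t (init x)).
Proof.
rewrite /code_run; set c := code_config _ _ _.
have Ec : encodes c (init x).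
  exists [::], (nseq x 1); split=> //=.
    by rewrite /c; congr code_config; elim: x {c} => //= x ->.
  by move=> i; rewrite nth_nseq /input_tape; case: ltnP.
elim: t c (init x) Ec => //= t IHt c C Ec; rewrite -iterS iterSr.
case E: (step (TM e) C) => [C'|]; first exact/IHt/(code_stepP Ec E).
have Ez := code_ruleP e Ec; rewrite E /= in Ez.
have Fc : code_step e c = c by rewrite /code_step Ez.
by rewrite Fc iter_fixpoint.
Qed.

Lemma code_haltedP e x t :
  code_halted e x t = ~~ isSome (step (TM e) (run (step (TM e)) t (init x))).
Proof. exact/code_ruleP/code_runP. Qed.

Definition code_left (p : nat) : nat :=
  if code_fst p == 0 then p
  else pair_code (code_tl (code_fst p))
         (code_cons (code_hd (code_fst p)) (code_snd p)).

(** The list of all cells from cell 0, obtained by moving left until the left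
    part of the tape is empty. *)
Definition code_rewind (c : nat) : nat :=
  code_snd (iter (code_fst (code_snd c)) code_left (code_snd c)).

Lemma code_rewindE q l r :
  code_rewind (code_config q (seq_code l) (seq_code r)) = seq_code (catrev l r).
Proof.
rewrite /code_rewind /code_config !code_sndK !code_fstK.
suff H k : size l <= k ->
    iter k code_left (pair_code (seq_code l) (seq_code r)) =
    pair_code 0 (seq_code (catrev l r)) by rewrite H ?code_sndK ?size_seq_code.
elim: l r k => [|x l IHl] r k le_k.
  by rewrite iter_fixpoint // /code_left code_fstK.
case: k le_k => // k le_k; rewrite iterSr {2}/code_left.
by rewrite !code_fstK !code_sndK code_hdE code_tlE /= -(IHl (x :: r) k le_k).
Qed.

Lemma rec_code_rewind m f : rec m f -> rec m (fun s => code_rewind (f s)).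
Proof.
apply: rec_comp1; apply: rec_code_snd.
apply: (rec_iter (F := fun _ => code_left)); [solve_rec | solve_rec |].
by rewrite /code_left; solve_rec.
Qed.
#[local] Hint Resolve rec_code_rewind : rec.

(** The machine is run until it halts, and the output is found by a search for
    the first cell of the final tape that does not hold a one. *)
Lemma rec_of_computable f : computable f -> rec 1 (fun s => f (s 0)).
Proof.
move=> [e fP].
have haltE x : exists t, code_halted e x t.
  by have [c [[[t <-] halt] _]] := fP x; exists t; rewrite code_haltedP halt.
pose T x := ex_minn (haltE x).
have RT : rec 1 (fun s => T (s 0)).
  apply: (rec_min (Q := fun s t => ~~ code_halted e (s 0) t)).
  - by solve_rec.
  - by move=> s; rewrite /T; case: ex_minnP => t ->.
  - move=> s t; rewrite /T; case: ex_minnP => t' _ min_t' lt_t.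
    by case: (boolP (code_halted _ _ _)) => // /min_t'; lia.
(* [out x] is the tape when the machine halts; the value is the length of its
   initial segment of ones *)
pose out x := code_rewind (code_run e x (T x)).
have outP x :
    exists2 t, (forall i, code_nth (out x) i = t i) & tape_output t (f x).
  have [C [[[n En] halt] outC]] := fP x; exists (c_tape C) => // i.
  have [l [r [Ec El Et]]] := code_runP e x (T x).
  rewrite /out Ec code_rewindE code_nthE -Et; congr (c_tape _ i).
  have : code_halted e x (T x) by rewrite /T; case: ex_minnP.
  rewrite code_haltedP; case E: (step _ _) => // _.
  have Hn := run_halted (T x) halt; have HT := run_halted n E.
  by rewrite -Hn -En -HT -!runD addnC.
apply: (rec_min (Q := fun s y => code_nth (out (s 0)) y == 1)).
- have RT2 : rec 2 (fun s => T (s 1)).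
    by apply: (rec_comp1 (F := T)) => //; solve_rec.
  by rewrite /out; solve_rec.
- by move=> s; have [t -> [_ ->]] := outP (s 0).
- by move=> s y lt_y; have [t tE [t1 _]] := outP (s 0); rewrite tE t1.
Qed.

(** * Oracle machines computing parities *)

Definition parity (A : set nat) (n u : nat) : bool :=
  odd (\sum_(i < n) (bit u i && (val i \in A))).

Definition orule_code (q b q' od : nat) : nat :=
  pair_code q (pair_code 1 (pair_code b
    (pair_code q' (pair_code 1 (pair_code 2 od))))).

Lemma orule_codeK q (b : bool) q' od : orule_decode (orule_code q b q' od) =
  ORule q 1 b q' 1 Stay (dir_decode od).
Proof.
by rewrite /orule_decode /orule_code /pair_code !Cantor.cancel_of_to; case: b.
Qed.

Definition parity_next (u i : nat) (p b : bool) : nat :=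
  2 * i.+1 + (p (+) (bit u i && b)).

Definition parity_block (u i : nat) : seq nat :=
  [:: orule_code (2 * i + false) false (parity_next u i false false) 1;
      orule_code (2 * i + false) true (parity_next u i false true) 1;
      orule_code (2 * i + true) false (parity_next u i true false) 1;
      orule_code (2 * i + true) true (parity_next u i true true) 1].

(** The table of a machine that walks along the oracle tape with the parity [p]
    of the selected elements seen so far; state [2 * i + p] is about to read
    cell [i]. After [n] cells the machine stops if the parity is odd, and
    otherwise loops because of the last two rules. The head of the work
    tape stays on cell 0, which holds a 1 because the input, the code of a
    nonempty table, is positive. *)
Definition parity_list (n u N : nat) : seq nat :=
  iteri N (fun i l => parity_block u i ++ l)
    [:: orule_code (2 * n) false (2 * n) 2; orule_code (2 * n) true (2 * n) 2].

Definition parity_code (n u : nat) : nat := seq_code (parity_list n u n).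

Lemma rec_parity_code m f g :
  rec m f -> rec m g -> rec m (fun s => parity_code (f s) (g s)).
Proof.
apply: rec_comp2.
pose R (q b q' od : nat) l := code_cons (orule_code q b q' od) l.
pose block (u i l : nat) :=
  R (2 * i + false) false (parity_next u i false false) 1
  (R (2 * i + false) true (parity_next u i false true) 1
  (R (2 * i + true) false (parity_next u i true false) 1
  (R (2 * i + true) true (parity_next u i true true) 1 l))).
apply: (@rec_ext _ (fun s => iteri (s 0) (block (s 1))
  (R (2 * s 0) false (2 * s 0) 2 (R (2 * s 0) true (2 * s 0) 2 0)))).
  move=> s; rewrite /parity_code; move: (s 0) (s 1) => n u.
  suff H N : iteri N (block u) (R (2 * n) false (2 * n) 2
      (R (2 * n) true (2 * n) 2 0)) = seq_code (parity_list n u N) by exact: H.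
  by elim: N => //= N ->.
apply: (rec_iteri (F := fun s => block (s 1))).
- by solve_rec.
- by rewrite /R /orule_code; solve_rec.
- by rewrite /block /R /orule_code /parity_next; solve_rec.
Qed.

#[local] Hint Resolve rec_parity_code : rec.

Lemma block_filter A u i c j (p : bool) : oc_state c = 2 * j + p ->
    oc_tape c (oc_head c) = 1 ->
  [seq r <- map orule_decode (parity_block u i) | oapplies A c r] =
  if i == j then let b := oc_ohead c \in A in
    [:: ORule (2 * j + p) 1 b (parity_next u j p b) 1 Stay Right]
  else [::].
Proof.
move=> Eq Et.
rewrite /= (orule_codeK _ false) (orule_codeK _ true) (orule_codeK _ false)
  (orule_codeK _ true) /oapplies Eq Et /=.
have -> : (2 * i + 0 == 2 * j + p) = (i == j) && ~~ p.
  by case: p {Eq} => /=; lia.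
have -> : (2 * i + 1 == 2 * j + p) = (i == j) && p by case: p {Eq} => /=; lia.
by case: (i =P j) => [->|_] //=; case: p {Eq}; case: (_ \in _).
Qed.

Lemma parity_filter A n u N c j (p : bool) : oc_state c = 2 * j + p ->
    oc_tape c (oc_head c) = 1 -> N <= n ->
  [seq r <- map orule_decode (parity_list n u N) | oapplies A c r] =
  let b := oc_ohead c \in A in
  if j < N then [:: ORule (2 * j + p) 1 b (parity_next u j p b) 1 Stay Right]
  else if (j == n) && ~~ p then [:: ORule (2 * n) 1 b (2 * n) 1 Stay Stay]
  else [::].
Proof.
move=> Eq Et; elim: N => [_|N IHN lt_Nn].
  rewrite /= (orule_codeK _ false) (orule_codeK _ true) /oapplies Eq Et /=.
  have -> : (2 * n == 2 * j + p) = (j == n) && ~~ p by case: p {Eq} => /=; lia.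
  by case: (_ \in _); case: ((j == n) && ~~ p).
have -> : parity_list n u N.+1 = parity_block u N ++ parity_list n u N by [].
rewrite map_cat filter_cat (block_filter _ _ _ Eq Et).
rewrite IHN ?(ltnW lt_Nn) //= [j < N.+1]ltnS [j <= N]leq_eqVlt [N == j]eq_sym.
case: (j =P N) => [->|_] //=; rewrite ltnn.
by rewrite (_ : (N == n) = false) //; apply/eqP; lia.
Qed.

Lemma parity_step A n u j (p : bool) t k : t 0 = 1 ->
  ostep A (OTM (parity_code n u)) (OConfig (2 * j + p) 0 t k) =
  if j < n then
    Some (OConfig (parity_next u j p (k \in A)) 0 (write t 0 1) k.+1)
  else if (j == n) && ~~ p then Some (OConfig (2 * n) 0 (write t 0 1) k)
  else None.
Proof.
move=> t0; rewrite /ostep /OTM /parity_code seq_codeK.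
rewrite (@parity_filter _ _ _ _ _ j p) //=.
by case: ifP => //; case: ifP.
Qed.

Lemma parity_run A n u i : i <= n -> exists2 t, t 0 = 1 &
  run (ostep A (OTM (parity_code n u))) i (oinit (parity_code n u)) =
  OConfig (2 * i + parity A i u) 0 t i.
Proof.
elim: i => [_|i IHi lt_in].
  exists (input_tape (parity_code n u)); last by rewrite /parity big_ord0.
  by rewrite /parity_code; case: (n).
have [t t0 Er] := IHi (ltnW lt_in); exists (write t 0 1) => //.
rewrite -[in run _ _ _]addn1 runD Er /= parity_step // lt_in /parity_next.
congr OConfig.
by rewrite /parity big_ord_recr /= oddD oddb.
Qed.

Lemma jump_parity A n u : (parity_code n u \in jump A) = parity A n u.
Proof.
set M := ostep A (OTM (parity_code n u)); set c0 := oinit (parity_code n u).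
have [t t0 Er] := parity_run A u (leqnn n).
have Em m : ~~ parity A n u -> exists2 t', t' 0 = 1 &
    run M (n + m) c0 = OConfig (2 * n) 0 t' n.
  move=> /[dup] /negPf np np'; elim: m => [|m [t' t'0 Em]].
    by exists t; rewrite ?addn0 // Er np addn0.
  exists (write t' 0 1) => //; rewrite addnS -addn1 runD Em /=.
  have := parity_step A n u n false n t'0.
  by rewrite addn0 ltnn eqxx /= -/M => ->.
apply/idP/idP => [/set_mem[c [[m Em'] halt]]|par].
  apply/negPn/negP => /(Em m)[t' t'0].
  rewrite addnC runD Em' (run_halted _ halt).
  move=> Ec; move: halt; rewrite Ec.
  have := parity_step A n u n false n t'0.
  by rewrite addn0 ltnn eqxx /= -/M => ->.
apply/mem_set; exists (OConfig (2 * n + parity A n u) 0 t n).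
split; first by exists n.
by rewrite parity_step // ltnn par andbF.
Qed.

(** * Decoding *)

(** Binary digit [x] of [u] is inverted. *)
Definition flip (n x u : nat) : nat := num (fun i => (i == x) (+) bit u i) n.

Lemma flipK n x u : u < 2 ^ n -> flip n x (flip n x u) = u.
Proof.
move=> lt_u; rewrite -[RHS](num_bit lt_u); apply: eq_num => i lt_i.
by rewrite bit_num // addbA addbb.
Qed.

Lemma rec_flip m f g h : rec m f -> rec m g -> rec m h ->
  rec m (fun s => flip (f s) (g s) (h s)).
Proof.
apply: rec_comp3; rewrite /flip /num.
by apply: (rec_sum (F := fun s i => ((i == s 1) (+) bit (s 2) i) * 2 ^ i));
  solve_rec.
Qed.
#[local] Hint Resolve rec_flip : rec.

Lemma parityE A n u :
  parity A n u = \big[addb/false]_(i < n) (bit u i && (val i \in A)).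
Proof.
rewrite /parity (big_morph odd oddD (erefl : odd 0 = false)).
by apply: eq_bigr => i _; rewrite oddb.
Qed.

Lemma parity_flip A n x u :
  x < n -> parity A n (flip n x u) = (x \in A) (+) parity A n u.
Proof.
move=> lt_x; rewrite !parityE.
under eq_bigr => i _ do rewrite bit_num // andb_addl.
rewrite big_split /=; congr addb.
rewrite (bigD1 (Ordinal lt_x)) //= eqxx big1 ?addbF // => i.
by rewrite -val_eqE /= => /negPf->.
Qed.

Lemma sum_flip n x (F : nat -> nat) :
  \sum_(u < 2 ^ n) F (flip n x u) = \sum_(u < 2 ^ n) F u.
Proof.
pose h (u : 'I_(2 ^ n)) := Ordinal (num_lt (fun i => (i == x) (+) bit u i) n).
have hK : involutive h by move=> u; apply: val_inj; apply: (@flipK n x u).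
by rewrite [RHS](reindex_inj (inv_inj hK)).
Qed.

(** Let [E u] say that [V u] is wrong. If neither [u] nor [flip n x u] is wrong,
    then [V u (+) V (flip n x u)] is the answer, since the true parities differ
    by [x \in A]. As [flip n x] permutes the numbers below 2^n, the number of
    wrong votes is at most twice the sum of [E], hence less than a quarter of
    all votes. *)
Lemma majority_decoding A n x (V : nat -> bool) : x < n ->
    8 * \sum_(u < 2 ^ n) (V u != parity A n u) < 2 ^ n ->
  (x \in A) = (2 ^ n < 2 * \sum_(u < 2 ^ n) (V u (+) V (flip n x u))).
Proof.
move=> lt_x; pose E u : nat := V u != parity A n u.
pose D u : nat := V u (+) V (flip n x u).
rewrite -/(\sum_(u < 2 ^ n) E u) -/(\sum_(u < 2 ^ n) D u) => ltE.
have sumE : \sum_(u < 2 ^ n) (E u + E (flip n x u)) = 2 * \sum_(u < 2 ^ n) E u.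
  by rewrite big_split /= (sum_flip n x E) mul2n addnn.
have sum1 : \sum_(u < 2 ^ n) 1 = 2 ^ n by rewrite sum1_card card_ord.
case: (boolP (x \in A)) => xA.
  have: \sum_(u < 2 ^ n) 1 <= \sum_(u < 2 ^ n) (D u + (E u + E (flip n x u))).
    apply: leq_sum => u _; rewrite /D /E parity_flip // xA.
    by case: (V u); case: (V _); case: (parity _ _ _).
  by rewrite big_split /= sumE sum1; lia.
have: \sum_(u < 2 ^ n) D u <= \sum_(u < 2 ^ n) (E u + E (flip n x u)).
  apply: leq_sum => u _; rewrite /D /E parity_flip // (negPf xA).
  by case: (V u); case: (V _); case: (parity _ _ _).
by rewrite sumE; lia.
Qed.

(** * Approximating the reduction *)

Lemma rec_big m (op : nat -> nat -> nat) idx (I : Type) (r : seq I)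
    (F : I -> (nat -> nat) -> nat) :
    (forall f g, rec m f -> rec m g -> rec m (fun s => op (f s) (g s))) ->
    (forall i, rec m (F i)) ->
  rec m (fun s => \big[op/idx]_(i <- r) F i s).
Proof.
move=> Rop RF; elim: r => [|i r IHr].
  by apply: (@rec_ext _ (fun=> idx)) (rec_const _ _) => s; rewrite big_nil.
apply: (@rec_ext _ (fun s => op (F i s) (\big[op/idx]_(j <- r) F j s))).
  by move=> s; rewrite big_cons.
exact: Rop.
Qed.

Lemma in_KP y : y \in K <-> exists t, code_halted y y t.
Proof.
split=> [/set_mem[c [[t <-] halt]]|[t]].
  by exists t; rewrite code_haltedP halt.
rewrite code_haltedP; case E: (step _ _) => // _.
by apply/mem_set; eexists; split; [exists t|].
Qed.

Lemma code_halted_le y t t' :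
  t <= t' -> code_halted y y t -> code_halted y y t'.
Proof.
move=> /subnKC <-; rewrite !code_haltedP runD; case E: (step _ _) => // _.
by rewrite run_halted // E.
Qed.

(** For fixed [k] there are finitely many truth assignments [b], and the value
    of the coded truth table is selected by a sum over them. The position of [b] in
    the table is a constant in each summand, so that the order in which the
    assignments are enumerated does not matter. *)
Lemma rec_guess k (ys : nat -> k.-tuple nat)
    (beta : nat -> {ffun k.-tuple bool -> bool}) :
    rec 1 (fun s => btt_code (ys (s 0)) (beta (s 0))) ->
  rec 2 (fun s => beta (s 0)
    [tuple of map (fun y => code_halted y y (s 1)) (ys (s 0))]).
Proof.
set h := fun e => btt_code (ys e) (beta e) => Rh.
have Rh2 : rec 2 (fun s => h (s 0)) by apply: (rec_comp1 (F := h)); solve_rec.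
pose y e (i : 'I_k) := code_nth (code_fst (h e)) i.
have yE e i : y e i = tnth (ys e) i.
  by rewrite /y /h /btt_code code_fstK code_nthE (tnth_nth 0).
apply: (@rec_ext _ (fun s => \sum_(b : k.-tuple bool)
    (\prod_(i < k)
       (code_halted (y (s 0) i) (y (s 0) i) (s 1) == tnth b i :> nat))
    * code_nth (code_snd (h (s 0))) (enum_rank b))).
  move=> s; set a := [tuple of _].
  rewrite (bigD1 a) //= big1 ?mul1n => [|i _]; last first.
    by rewrite yE /a tnth_map eqxx.
  rewrite /h /btt_code code_sndK code_nthE (nth_map false); last first.
    by rewrite size_codom.
  rewrite nth_codom enum_rankK big1 ?addn0 // => b neb.
  have /existsP[i nei] : [exists i, tnth a i != tnth b i].
    rewrite -negb_forall; apply: contra neb => /forallP eqab.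
    by apply/eqP/eq_from_tnth => i; apply/esym/eqP/eqab.
  rewrite (bigD1 i) //= yE; move: nei; rewrite tnth_map => /negPf.
  by case: code_halted; case: (tnth b i) => //; rewrite mul0n.
apply: rec_big => [f g|b]; first exact: rec_addn.
apply: rec_muln; last by solve_rec.
apply: rec_big => [f g|i]; first exact: rec_muln.
by rewrite /y; solve_rec.
Qed.

Theorem theorem3p3 (A : set nat) : superduperlow A -> computable_set A.
Proof.
move=> [k [ys [beta [/rec_of_computable Rh jumpE]]]].
have Rguess := rec_guess Rh.
pose guess e t := beta e [tuple of map (fun y => code_halted y y t) (ys e)].
pose V n t u := guess (parity_code n u) t.
have RV m f g h : rec m f -> rec m g -> rec m h ->
  rec m (fun s => V (f s) (g s) (h s)).
  move=> Rf Rg Rh'.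
  by apply: (@rec_comp2 _ (fun e t => guess e t)) => //; solve_rec.
pose code e := btt_code (ys e) (beta e).
pose y n u i := code_nth (code_fst (code (parity_code n u))) i.
have yE n u (i : 'I_k) : y n u i = tnth (ys (parity_code n u)) i.
  by rewrite /y /code /btt_code code_fstK code_nthE (tnth_nth 0).
pose cnt n t := \sum_(u < 2 ^ n) \sum_(i < k) code_halted (y n u i) (y n u i) t.
pose c n := \sum_(u < 2 ^ n) \sum_(i < k) (y n u i \in K).
have Rcnt m f g : rec m f -> rec m g -> rec m (fun s => cnt (f s) (g s)).
  apply: rec_comp2; apply: (rec_sum (F := fun s u =>
    \sum_(i < k) code_halted (y (s 0) u i) (y (s 0) u i) (s 1))).
    by solve_rec.
  apply: rec_big => [f' g'|i]; first exact: rec_addn.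
  have Ry : rec 3 (fun s => y (s 1) (s 0) i).
    rewrite /y; apply: rec_code_nth (rec_const _ _); apply: rec_code_fst.
    by apply: (rec_comp1 (F := code)) => //; solve_rec.
  by solve_rec.
(* stage at which all positive answers for [n] have been found *)
have cnt_lim n : exists t, c n <= cnt n t.
  have /choice[T TP] z : exists t, z \in K -> code_halted z z t.
    case: (boolP (z \in K)) => [/in_KP[t zt]|_]; last by exists 0.
    by exists t.
  exists (\max_(u < 2 ^ n) \max_(i < k) T (y n u i)).
  apply: leq_sum => u _; apply: leq_sum => i _.
  case: (boolP (_ \in K)) => // /TP /code_halted_le -> //.
  pose Tmax (u : 'I_(2 ^ n)) := \max_(i < k) T (y n u i).
  apply: leq_trans (leq_bigmax (F := Tmax) u).
  exact: (leq_bigmax (F := fun i : 'I_k => T (y n u i))).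
(* a wrong guess is paid for by a positive answer still to come *)
have errE n t : \sum_(u < 2 ^ n) (V n t u != parity A n u) + cnt n t <= c n.
  rewrite -big_split; apply: leq_sum => u _ /=.
  have le_i (i : 'I_k) : code_halted (y n u i) (y n u i) t <= (y n u i \in K).
    case E: code_halted => //; rewrite (_ : _ \in K) //.
    by apply/in_KP; exists t.
  case: (eqVneq (V n t u)) => [_|]; first exact: leq_sum.
  rewrite -jump_parity jumpE => neV.
  have /existsP[i nei] : [exists i : 'I_k,
      code_halted (y n u i) (y n u i) t != (y n u i \in K)].
    rewrite -negb_forall; apply: contra neV => /forallP eqK; apply/eqP.
    congr (fun_of_fin _ _); apply: eq_from_tnth => i.
    by rewrite !tnth_map -yE; exact: (eqP (eqK i)).
  rewrite (bigD1 i) //= [leqRHS](bigD1 i) //= addnA leq_add //.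
    by move: (le_i i) nei; case: code_halted; case: (_ \in K).
  exact: leq_sum.
have c_le n : c n <= k * 2 ^ n.
  apply: (@leq_trans (\sum_(u < 2 ^ n) \sum_(i < k) 1)).
    by apply: leq_sum => u _; apply: leq_sum => i _; case: (_ \in _).
  by rewrite !sum_nat_const !card_ord muln1 mulnC.
(* [j] and [n0] express the upper limit of c(n) / 2^n up to 1/8 *)
pose often j := `[< forall N, exists2 n, N <= n & j * 2 ^ n <= 8 * c n >].
have often0 : exists j, often j by exists 0; apply/asboolP => N; exists N.
have often_le j : often j -> j <= 8 * k.
  move=> /asboolP/(_ 0)[n _ lej].
  rewrite -(leq_pmul2r (expn_gt0 2 n : 0 < 2 ^ n)).
  by have := c_le n; lia.
case: (ex_maxnP often0 often_le) => j /asboolP jP jmax.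
have [n0 n0P] : exists n0, forall n, n0 <= n -> 8 * c n < j.+1 * 2 ^ n.
  apply: contrapT => no; have /jmax : often j.+1; last by rewrite ltnn.
  apply/asboolP => N; apply: contrapT => noN; apply: no; exists N => n le_n.
  by rewrite ltnNge; apply/negP => le_j; apply: noN; exists n.
(* [w] codes the pair of a length [n] and a stage [t] *)
pose test x w := [&& n0 <= code_fst w, x < code_fst w &
  j * 2 ^ code_fst w <= 8 * cnt (code_fst w) (code_snd w)].
have testP x : exists w, test x w.
  have [n] := jP (maxn n0 x.+1); rewrite geq_max => /andP[le_n lt_x] le_j.
  have [t le_c] := cnt_lim n; exists (pair_code n t).
  by rewrite /test code_fstK code_sndK le_n lt_x; lia.
pose w x := ex_minn (testP x).
have Rtest : rec 2 (fun s => ~~ test (s 1) (s 0)).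
  rewrite /test; apply: rec_neg; apply: rec_and; first by solve_rec.
  apply: rec_and; first by solve_rec.
  apply: rec_leq; first by solve_rec.
  by apply: rec_muln; [solve_rec | apply: Rcnt; solve_rec].
have Rw : rec 1 (fun s => w (s 0)).
  apply: (rec_min (Q := fun s v => ~~ test (s 0) v)) => // s; rewrite /w.
    by case: ex_minnP => v ->.
  move=> v; case: ex_minnP => v' _ minv' lt_v.
  by case: (boolP (test _ _)) => // /minv'; lia.
pose n x := code_fst (w x).
pose vote x u := V (n x) (code_snd (w x)) u (+)
                 V (n x) (code_snd (w x)) (flip (n x) x u).
apply: computable_of_rec.
apply: (@rec_ext _ (fun s =>
  2 ^ n (s 0) < 2 * \sum_(u < 2 ^ n (s 0)) vote (s 0) u)).
  move=> s; congr nat_of_bool; apply/esym; rewrite /vote /n /w.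
  case: ex_minnP => v /and3P[le_n lt_x le_j] _.
  apply: majority_decoding => //.
  by have := n0P _ le_n; have := errE (code_fst v) (code_snd v); lia.
have Rw2 : rec 2 (fun s => w (s 1)).
  by apply: (rec_comp1 (F := w)) => //; solve_rec.
have Rn : rec 1 (fun s => n (s 0)) by rewrite /n; solve_rec.
apply: rec_leq; first by solve_rec.
apply: rec_muln; first by solve_rec.
apply: (rec_sum (F := fun s u => vote (s 0) u)); first by solve_rec.
by rewrite /vote /n; apply: rec_addb; apply: RV; solve_rec.
Qed.
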